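(* Let $z_1,z_2$ be real numbers with $\tfrac12<z_1<1<z_2<\tfrac32$, and let $\varphi$, $\widehat\varphi$ and the trigonometric polynomials $F_n$ ($n\ge 1$) be the objects determined by $z_1,z_2$ as defined in the context. Then, as $n\to\infty$, $$\frac{\|F_n\|_C}{\|F_n\|_L}\ \ge\ \rho(z_1,z_2)\,n+O(n^{-1}),$$ where $$\rho(z_1,z_2)=\widehat\varphi(0)\biggl[4\biggl(\int_0^{1/4}\widehat\varphi(z)\,dz+\int_{3/4}^{5/4}\widehat\varphi(z)\,dz-\int_{z_1}^{z_2}\widehat\varphi(z)\,dz\biggr)\biggr]^{-1}.$$ (Here $z_1,z_2$ are fixed, and the constant implied by $O(n^{-1})$ may depend on them.)
   Context: Notation: $e(t)=\exp(2\pi i t)$, $c(t)=\cos(2\pi t)$, $s(t)=\sin(2\pi t)$. For a real trigonometric polynomial $t(x)=\sum_{\nu\in\mathbb Z,\,|\nu|<n}\widehat t(\nu)e(\nu x)$ put $$\|t\|_C=\max_{|x|\le 1/2}|t(x)|,\qquad \|t\|_L=\int_{-1/2}^{1/2}|t(x)|\,dx.$$ Let $q_k=k/2-1/4$, so $q_1=\tfrac14$, $q_2=\tfrac34$, $q_3=\tfrac54$ (zeros of $c$). For $\tfrac12<z_1<1<z_2<\tfrac32$ define $$\omega(z)=\frac{(z_1^2-z^2)(z_2^2-z^2)}{(q_1^2-z^2)(q_2^2-z^2)(q_3^2-z^2)},\qquad \omega_k(z)=(q_k^2-z^2)\,\omega(z)\quad(k=1,2,3),$$ where $\omega_k(q_k)$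 is understood after cancelling the factor $q_k^2-z^2$. For $k=1,2,3$ let $\sigma_k(x)=\frac{\pi}{q_k}\,s\bigl(q_k(1-|x|)\bigr)$ for $|x|<1$ and $\sigma_k(x)=0$ for $|x|\ge 1$. Define the even function $$\varphi(x)=\sum_{k=1}^3\omega_k(q_k)\,\sigma_k(x),\qquad x\in\mathbb R.$$ Its Fourier transform is $\widehat\varphi(z)=\int_{\mathbb R}\varphi(x)e(-zx)\,dx$, which equals $\omega(z)c(z)$ (with removable singularities at $z=\pm q_k$, $k=1,2,3$, filled in by continuity). For $n\ge 1$ define $$F_n(x)=\sum_{\nu\in\mathbb Z,\ |\nu|<n}\varphi\bigl(\tfrac{\nu}{n}\bigr)\,e(\nu x).$$ *)

(* Defs.v *)
From Stdlib Require Import Reals List Lra Lia.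
From Coquelicot Require Import Coquelicot.
Import ListNotations.
Open Scope R_scope.

(** [cexp t = exp (2 pi i t)]. *)
Definition cexp (t : R) : C := (cos (2 * PI * t), sin (2 * PI * t)).

Definition q (k : nat) : R := INR k / 2 - 1 / 4.

(** [omega z1 z2 k z] is [(q k ^ 2 - z ^ 2) * omega z1 z2 z] with the factor
    [q k ^ 2 - z ^ 2] cancelled, so that its value at [z = q k] is the intended
    one; see [omega_kE]. *)
Definition omega (z1 z2 z : R) : R :=
  ((z1 ^ 2 - z ^ 2) * (z2 ^ 2 - z ^ 2)) /
  ((q 1 ^ 2 - z ^ 2) * (q 2 ^ 2 - z ^ 2) * (q 3 ^ 2 - z ^ 2)).

Definition omega_k (z1 z2 : R) (k : nat) (z : R) : R :=
  ((z1 ^ 2 - z ^ 2) * (z2 ^ 2 - z ^ 2)) /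
  fold_right Rmult 1
    (map (fun j => q j ^ 2 - z ^ 2)
       (filter (fun j => negb (Nat.eqb j k)) [1; 2; 3]%nat)).

Lemma omega_kE (z1 z2 : R) (k : nat) (z : R) :
  In k [1; 2; 3]%nat ->
  (forall j, In j [1; 2; 3]%nat -> q j ^ 2 <> z ^ 2) ->
  omega_k z1 z2 k z = (q k ^ 2 - z ^ 2) * omega z1 z2 z.
Proof.
intros Hk Hz.
assert (H1 : q 1 ^ 2 - z ^ 2 <> 0) by (apply Rminus_eq_contra, Hz; simpl; auto).
assert (H2 : q 2 ^ 2 - z ^ 2 <> 0) by (apply Rminus_eq_contra, Hz; simpl; auto).
assert (H3 : q 3 ^ 2 - z ^ 2 <> 0) by (apply Rminus_eq_contra, Hz; simpl; auto).
unfold omega, omega_k.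
destruct Hk as [<- | [<- | [<- | []]]]; cbn [filter Nat.eqb negb map fold_right];
  field; auto.
Qed.

Definition sigma (k : nat) (x : R) : R :=
  if Rlt_dec (Rabs x) 1
  then PI / q k * sin (2 * PI * (q k * (1 - Rabs x)))
  else 0.

Definition phi (z1 z2 x : R) : R :=
  sum_n_m (fun k => omega_k z1 z2 k (q k) * sigma k x) 1 3.

(** Fourier transform, as a complex-valued improper Riemann integral. *)
Definition phihat (z1 z2 z : R) : C :=
  RInt_gen (V := C_R_CompleteNormedModule)
    (fun x => Cmult (RtoC (phi z1 z2 x)) (cexp (- z * x)))
    (Rbar_locally m_infty) (Rbar_locally p_infty).

(** The sum over the integers [nu] with [|nu| < n] is indexed by
    [nu = j - n], [1 <= j <= 2 n - 1]. *)
Definition F (z1 z2 : R) (n : nat) (x : R) : C :=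
  sum_n_m (G := C_AbelianMonoid)
    (fun j => let nu := INR j - INR n in
       Cmult (RtoC (phi z1 z2 (nu / INR n))) (cexp (nu * x)))
    1 (2 * n - 1).

(** For a trigonometric polynomial (a continuous function) the supremum is
    finite and is a maximum. *)
Definition normC (t : R -> C) : R :=
  real (Lub_Rbar (fun y => exists x, Rabs x <= 1 / 2 /\ y = Cmod (t x))).

Definition normL (t : R -> C) : R :=
  RInt (fun x => Cmod (t x)) (- (1 / 2)) (1 / 2).

(** [phihat z1 z2] is real-valued because [phi z1 z2] is even ([phihat_real]
    below), so taking real parts loses nothing. *)
Definition rho (z1 z2 : R) : R :=
  let g := fun z => Re (phihat z1 z2 z) in
  g 0 * / (4 * (RInt g 0 (1 / 4) + RInt g (3 / 4) (5 / 4) - RInt g z1 z2)).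

Lemma sigma_out (k : nat) (x : R) : 1 <= Rabs x -> sigma k x = 0.
Proof. intros H; unfold sigma; destruct (Rlt_dec (Rabs x) 1); lra. Qed.

Lemma phi_out (z1 z2 x : R) : 1 <= Rabs x -> phi z1 z2 x = 0.
Proof.
intros H; unfold phi.
rewrite !sum_Sn_m, sum_n_m_zero by lia.
unfold plus, zero; simpl; rewrite !sigma_out by assumption; ring.
Qed.

Lemma phi_even (z1 z2 x : R) : phi z1 z2 (- x) = phi z1 z2 x.
Proof.
unfold phi; apply sum_n_m_ext; intros k; unfold sigma; rewrite Rabs_Ropp; auto.
Qed.

Definition phi_in (z1 z2 x : R) : R :=
  sum_n_m (fun k => omega_k z1 z2 k (q k) *
    (PI / q k * sin (2 * PI * (q k * (1 - Rabs x))))) 1 3.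

Lemma phi_inE (z1 z2 x : R) : Rabs x < 1 -> phi z1 z2 x = phi_in z1 z2 x.
Proof.
intros H; apply sum_n_m_ext; intros k; unfold sigma.
destruct (Rlt_dec (Rabs x) 1); lra.
Qed.

Lemma continuous_phi_in (z1 z2 x : R) : continuous (phi_in z1 z2) x.
Proof.
assert (Hk : forall k, continuous (fun y => omega_k z1 z2 k (q k) *
    (PI / q k * sin (2 * PI * (q k * (1 - Rabs y))))) x).
{ intros k.
  apply (continuous_scal_r (K := R_AbsRing) (V := R_NormedModule)).
  apply (continuous_scal_r (K := R_AbsRing) (V := R_NormedModule)).
  apply (continuous_comp _ sin); [| apply continuous_sin].
  apply (continuous_scal_r (K := R_AbsRing) (V := R_NormedModule)).
  apply (continuous_scal_r (K := R_AbsRing) (V := R_NormedModule)).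
  apply (continuous_minus (K := R_AbsRing) (V := R_NormedModule)).
  - apply continuous_const.
  - apply continuous_Rabs. }
unfold phi_in.
apply continuous_ext with (fun y => plus
  (omega_k z1 z2 1 (q 1) * (PI / q 1 * sin (2 * PI * (q 1 * (1 - Rabs y)))))
  (plus
  (omega_k z1 z2 2 (q 2) * (PI / q 2 * sin (2 * PI * (q 2 * (1 - Rabs y)))))
  (omega_k z1 z2 3 (q 3) * (PI / q 3 * sin (2 * PI * (q 3 * (1 - Rabs y))))))).
{ intros y; rewrite !sum_Sn_m, sum_n_m_zero by lia; unfold plus, zero; simpl; unfold plus, zero, opp; simpl; lra. }
apply (continuous_plus (K := R_AbsRing) (V := R_NormedModule)); [apply (Hk 1%nat) |].
apply (continuous_plus (K := R_AbsRing) (V := R_NormedModule));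
  [apply (Hk 2%nat) | apply (Hk 3%nat)].
Qed.

Lemma ex_RInt_phi_mul (z1 z2 : R) (g : R -> R) :
  (forall x, continuous g x) -> ex_RInt (fun x => phi z1 z2 x * g x) (- 1) 1.
Proof.
intros Hg.
apply ex_RInt_ext with (fun x => phi_in z1 z2 x * g x).
{ intros x; rewrite Rmin_left, Rmax_right by lra; intros Hx.
  rewrite phi_inE; auto; apply Rabs_def1; lra. }
apply (ex_RInt_continuous (V := R_CompleteNormedModule)); intros x _.
apply (continuous_mult (K := R_AbsRing)); [apply continuous_phi_in | apply Hg].
Qed.

Lemma is_RInt_phi_mul (z1 z2 : R) (g : R -> R) (a b : R) :
  (forall x, continuous g x) -> a < - 1 -> 1 < b ->
  is_RInt (fun x => phi z1 z2 x * g x) a b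
    (RInt (fun x => phi z1 z2 x * g x) (- 1) 1).
Proof.
intros Hg Ha Hb.
assert (H0 : forall u v, u <= v -> (v <= - 1 \/ 1 <= u) ->
  is_RInt (fun x => phi z1 z2 x * g x) u v 0).
{ intros u v Huv Hout.
  apply is_RInt_ext with (fun _ => 0).
  { intros x; rewrite Rmin_left, Rmax_right by lra; intros Hx.
    rewrite phi_out; [symmetry; apply Rmult_0_l |].
    destruct Hout; [rewrite Rabs_left | rewrite Rabs_right]; lra. }
  assert (Hc := is_RInt_const (V := R_NormedModule) u v 0).
  change (is_RInt (fun _ => 0) u v ((v - u) * 0)) in Hc.
  rewrite Rmult_0_r in Hc; exact Hc. }
set (I := RInt _ _ _).
replace I with (plus (plus 0 I) 0) by (unfold plus; simpl; ring).
apply (is_RInt_Chasles (V := R_NormedModule)) with 1; [| apply H0; lra].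
apply (is_RInt_Chasles (V := R_NormedModule)) with (- 1); [apply H0; lra |].
apply (RInt_correct (V := R_CompleteNormedModule)), ex_RInt_phi_mul, Hg.
Qed.

Lemma phihatE (z1 z2 z : R) :
  phihat z1 z2 z =
  (RInt (fun x => phi z1 z2 x * cos (2 * PI * (- z * x))) (- 1) 1,
   RInt (fun x => phi z1 z2 x * sin (2 * PI * (- z * x))) (- 1) 1).
Proof.
unfold phihat; apply (is_RInt_gen_unique (V := C_R_CompleteNormedModule)).
assert (Hl : forall x, continuous (fun y : R => 2 * PI * (- z * y)) x).
{ intros x.
  apply (continuous_scal_r (K := R_AbsRing) (V := R_NormedModule)).
  apply (continuous_scal_r (K := R_AbsRing) (V := R_NormedModule)).
  apply continuous_id. }
intros P HP.
exists (fun a => a < - 1) (fun b => 1 < b).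
{ exists (- 1); auto. }
{ exists 1; auto. }
intros a b Ha Hb; eexists; split; [| apply locally_singleton, HP].
apply (is_RInt_fct_extend_pair (U := R_NormedModule) (V := R_NormedModule)).
- apply is_RInt_ext with (fun x => phi z1 z2 x * cos (2 * PI * (- z * x))).
  { intros x _; simpl; lra. }
  apply is_RInt_phi_mul; auto.
  intros x; apply (continuous_comp _ cos); [apply Hl | apply continuous_cos].
- apply is_RInt_ext with (fun x => phi z1 z2 x * sin (2 * PI * (- z * x))).
  { intros x _; simpl; lra. }
  apply is_RInt_phi_mul; auto.
  intros x; apply (continuous_comp _ sin); [apply Hl | apply continuous_sin].
Qed.

Lemma phihat_real (z1 z2 z : R) : phihat z1 z2 z = RtoC (Re (phihat z1 z2 z)).
Proof.
rewrite phihatE; unfold RtoC, Re; simpl; f_equal.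
set (f := fun x => phi z1 z2 x * sin (2 * PI * (- z * x))).
assert (Hf : ex_RInt f (- 1) 1).
{ apply ex_RInt_phi_mul; intros x.
  apply (continuous_comp _ sin); [| apply continuous_sin].
  apply (continuous_scal_r (K := R_AbsRing) (V := R_NormedModule)).
  apply (continuous_scal_r (K := R_AbsRing) (V := R_NormedModule)).
  apply continuous_id. }
apply (RInt_correct (V := R_CompleteNormedModule)) in Hf.
set (I := RInt f (- 1) 1) in *.
assert (H2 : is_RInt f (- 1) 1 (opp I)).
{ assert (H4 : is_RInt f (Ropp 1) (Ropp (-1)) I).
  { replace (Ropp (-1)) with 1 by lra; replace (Ropp 1) with (-1) by lra; exact Hf. }
  assert (H5 := is_RInt_comp_opp (V := R_NormedModule) f 1 (-1) I H4).
  apply is_RInt_swap in H5.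
  apply is_RInt_ext with (2 := H5).
  intros x _; unfold f, opp; simpl.
  rewrite phi_even.
  replace (2 * PI * (- z * - x)) with (- (2 * PI * (- z * x))) by ring.
  rewrite sin_neg; lra. }
assert (H6 : opp I = I).
{ transitivity (RInt f (- 1) 1); [symmetry |]; apply is_RInt_unique; auto. }
unfold opp in H6; simpl in H6; lra.
Qed.

(* Main.v *)
Require Import Defs.
From Stdlib Require Import Reals Lra Lia.
From Coquelicot Require Import Coquelicot.
Open Scope R_scope.

(** Write [F_n (x) = n h_n (n x)], where [h_n (y)] is the trapezoidal sum with [n]
    nodes for the cosine transform [phihat y = omega y cos (2 PI y)]; uniformly for
    [0 <= y <= 7/4] the two differ by [O(n^-2)].  At [y = 0] this bounds the maximum
    of [F_n] from below.  For the [L]-norm, i.e. twice the integral of [|h_n|] over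
    [[0, n/2]], the range [y >= 7/4] is computed exactly: since [cos (2 PI q_k) = 0], [h_n y]
    is [cos (2 PI y)] times a rational function of [cos (2 PI y / n)], which for
    large [n] is negative there, so [|h_n| = - sgn (cos (2 PI y)) h_n]; and [h_n],
    having frequencies below [n] in [x = y/n], is orthogonal to [sgn (cos (2 PI y))]
    on [[0, n/2]].  Hence the integral over [[7/4, n/2]] is that of
    [sgn (cos (2 PI y)) h_n] over [[0, 7/4]], where [h_n] may be replaced by
    [phihat], whose sign changes on [[0, 7/4]] are at [z1] and [z2] only. *)

(** * Finite sums, integrals and the trapezoidal rule *)

(** Sums start at 1 because the node 0 always needs a term of its own: it has half weight in the
    trapezoidal rule and frequency 0 in the cosine sums. *)
Definition sum1 (f : nat -> R) (m : nat) : R := sum_n_m f 1 m.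

Lemma sum1_0 (f : nat -> R) : sum1 f 0 = 0.
Proof. apply (sum_n_m_zero (G := R_AbelianMonoid)); lia. Qed.

Lemma sum1_S (f : nat -> R) (m : nat) : sum1 f (S m) = sum1 f m + f (S m).
Proof. apply (sum_n_Sm (G := R_AbelianMonoid)); lia. Qed.

Lemma sum1_ext (f g : nat -> R) (m : nat) :
  (forall i, (1 <= i <= m)%nat -> f i = g i) -> sum1 f m = sum1 g m.
Proof. intros H; apply sum_n_m_ext_loc; exact H. Qed.

Lemma sum1_plus (f g : nat -> R) (m : nat) :
  sum1 (fun i => f i + g i) m = sum1 f m + sum1 g m.
Proof. apply (sum_n_m_plus (G := R_AbelianMonoid)). Qed.

Lemma sum1_mult_l (c : R) (f : nat -> R) (m : nat) :
  sum1 (fun i => c * f i) m = c * sum1 f m.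
Proof. apply (sum_n_m_mult_l (K := R_Ring)). Qed.

Lemma Rabs_sum1_le (f g : nat -> R) (m : nat) :
  (forall i, (1 <= i <= m)%nat -> Rabs (f i) <= g i) ->
  Rabs (sum1 f m) <= sum1 g m.
Proof.
induction m as [|m IH]; intros H.
- rewrite !sum1_0, Rabs_R0; lra.
- rewrite !sum1_S.
  apply Rle_trans with (1 := Rabs_triang _ _), Rplus_le_compat.
  + apply IH; intros i Hi; apply H; lia.
  + apply H; lia.
Qed.

Lemma is_derive_sum1 (f : nat -> R -> R) (df : nat -> R) (x : R) (m : nat) :
  (forall i, (1 <= i <= m)%nat -> is_derive (f i) x (df i)) ->
  is_derive (fun y => sum1 (fun i => f i y) m) x (sum1 df m).
Proof.
induction m as [|m IH]; intros H.
- rewrite sum1_0; apply is_derive_ext with (fun _ => 0).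
  + intros y; symmetry; apply sum1_0.
  + apply (is_derive_const (K := R_AbsRing) (V := R_NormedModule)).
- rewrite sum1_S.
  apply is_derive_ext with (fun y => plus (sum1 (fun i => f i y) m) (f (S m) y)).
  + intros y; symmetry; apply sum1_S.
  + apply (is_derive_plus (K := R_AbsRing) (V := R_NormedModule)).
    * apply IH; intros i Hi; apply H; lia.
    * apply H; lia.
Qed.

(** Undoes the index shift in the definition of [F] and pairs the frequencies nu and - nu. Raising
    [n] by one adds one term at each end and shifts all the other indices by one. *)
Lemma sum_n_m_symmetric (f : R -> R) (n : nat) :
  sum_n_m (fun j => f (INR j - INR (S n))) 1 (2 * S n - 1) =
  f 0 + sum1 (fun i => f (INR i) + f (- INR i)) n.
Proof.
induction n as [|n IH].
- rewrite sum1_0; simpl (2 * 1 - 1)%nat; rewrite sum_n_n, Rplus_0_r.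
  f_equal; lra.
- rewrite sum1_S, <- Rplus_assoc, <- IH.
  replace (2 * S (S n) - 1)%nat with (S (S (2 * S n - 1))) by lia.
  rewrite sum_n_Sm, sum_Sn_m, <- sum_n_m_S by lia.
  rewrite (sum_n_m_ext (fun k => f (INR (S k) - INR (S (S n))))
    (fun j => f (INR j - INR (S n)))).
  2: { intros k; f_equal; rewrite !S_INR; lra. }
  change (@plus R_AbelianMonoid) with Rplus.
  replace (INR (S (S (2 * S n - 1))) - INR (S (S n))) with (INR (S n)).
  2: { rewrite !S_INR, minus_INR, mult_INR, !S_INR by lia; simpl; lra. }
  replace (INR 1 - INR (S (S n))) with (- INR (S n)) by (rewrite !S_INR; simpl; lra).
  change (@plus (AbelianMonoid.Pack R (AbelianMonoid.class R_AbelianMonoid) R)) with Rplus.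
  lra.
Qed.

Lemma sum_n_m_C (f : nat -> C) (a b : nat) :
  sum_n_m (G := C_AbelianMonoid) f a b =
  (sum_n_m (fun i => Re (f i)) a b, sum_n_m (fun i => Im (f i)) a b).
Proof.
destruct (Nat.lt_ge_cases b a) as [H|H].
- rewrite !sum_n_m_zero by lia; reflexivity.
- induction H as [|b H IH].
  + rewrite !sum_n_n; apply surjective_pairing.
  + rewrite !sum_n_Sm, IH by lia; reflexivity.
Qed.

Lemma is_derive_continuous (f : R -> R) (x l : R) :
  is_derive f x l -> continuous f x.
Proof.
intros H; apply (ex_derive_continuous (K := R_AbsRing) (V := R_NormedModule)).
exists l; exact H.
Qed.

Lemma ex_RInt_of_continuous (f : R -> R) (a b : R) :
  (forall x, continuous f x) -> ex_RInt f a b.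
Proof.
intros H; apply (ex_RInt_continuous (V := R_CompleteNormedModule)); auto.
Qed.

Lemma RInt_split (f : R -> R) (a b c : R) :
  (forall x, continuous f x) -> RInt f a c = RInt f a b + RInt f b c.
Proof.
intros H; symmetry.
apply (RInt_Chasles (V := R_CompleteNormedModule)); apply ex_RInt_of_continuous, H.
Qed.

Lemma RInt_even (f : R -> R) (a : R) :
  (forall x, continuous f x) -> (forall x, f (- x) = f x) ->
  RInt f (- a) a = 2 * RInt f 0 a.
Proof.
intros Hc He; rewrite (RInt_split f _ 0) by exact Hc.
enough (E : RInt f (- a) 0 = RInt f 0 a) by lra.
apply (is_RInt_unique (V := R_CompleteNormedModule)).
assert (H : is_RInt f (- 0) (- - a) (RInt f 0 a)).
{ rewrite Ropp_0, Ropp_involutive.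
  apply (RInt_correct (V := R_CompleteNormedModule)), ex_RInt_of_continuous, Hc. }
apply (is_RInt_comp_opp (V := R_NormedModule)), (is_RInt_swap (V := R_NormedModule)),
  (is_RInt_opp (V := R_NormedModule)) in H.
rewrite opp_opp in H.
apply is_RInt_ext with (2 := H); intros x _.
rewrite opp_opp; apply He.
Qed.

Lemma RInt_approx (f g : R -> R) (a b d : R) :
  a <= b -> (forall x, continuous f x) -> (forall x, continuous g x) ->
  (forall x, a <= x <= b -> Rabs (f x - g x) <= d) ->
  Rabs (RInt f a b - RInt g a b) <= (b - a) * d.
Proof.
intros Hab Hf Hg H.
assert (E := RInt_minus (V := R_CompleteNormedModule) f g a b
  (ex_RInt_of_continuous _ _ _ Hf) (ex_RInt_of_continuous _ _ _ Hg)).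
change (RInt f a b - RInt g a b) with (minus (RInt f a b) (RInt g a b)).
rewrite <- E.
apply abs_RInt_le_const; auto.
apply ex_RInt_of_continuous; intros x.
apply (continuous_minus (K := R_AbsRing) (V := R_NormedModule)); auto.
Qed.

(* The error over one interval, as a function of its length, vanishes at 0 and
   has derivative [O(M t^2)]. *)
Lemma trapezoid_one (g g1 g2 : R -> R) (M a t : R) :
  (forall x, is_derive g x (g1 x)) -> (forall x, is_derive g1 x (g2 x)) ->
  (forall x, Rabs (g2 x) <= M) -> 0 <= t ->
  Rabs (RInt g a (a + t) - t * ((g a + g (a + t)) / 2)) <= M / 2 * t ^ 3.
Proof.
intros H1 H2 HM Ht.
assert (Hc : forall x, continuous g x).
{ intros x; apply (is_derive_continuous _ _ _ (H1 x)). }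
assert (MVT' : forall (f df : R -> R) u v, (forall x, is_derive f x (df x)) -> u <= v ->
  exists c, u <= c <= v /\ f v - f u = df c * (v - u)).
{ intros f df u v Hd Huv.
  destruct (MVT_gen f u v df) as [c [Hc' E]].
  - intros; apply Hd.
  - intros; apply continuity_pt_filterlim, (is_derive_continuous _ _ _ (Hd _)).
  - rewrite Rmin_left, Rmax_right in Hc' by lra; eauto. }
set (E := fun s => RInt g a (a + s) - s * ((g a + g (a + s)) / 2)).
set (dE := fun s => g (a + s) - ((g a + g (a + s)) / 2 + s * (g1 (a + s) / 2))).
assert (HE : forall s, is_derive E s (dE s)).
{ intros s; unfold E, dE.
  apply (is_derive_minus (K := R_AbsRing) (V := R_NormedModule)
    (fun s => RInt g a (a + s)) (fun s => s * ((g a + g (a + s)) / 2))).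
  - replace (g (a + s)) with (scal 1 (g (a + s))) by (change (1 * g (a + s) = g (a + s)); ring).
    apply (is_derive_comp (K := R_AbsRing) (V := R_NormedModule) (RInt g a) (fun s => a + s)).
    + apply (is_derive_RInt (V := R_CompleteNormedModule) g _ a).
      * apply filter_forall; intros x.
        apply (RInt_correct (V := R_CompleteNormedModule)), ex_RInt_of_continuous, Hc.
      * apply Hc.
    + auto_derive; auto; ring.
  - auto_derive; [eexists; apply H1|].
    rewrite (is_derive_unique _ _ _ (H1 _)); field. }
destruct (MVT' E dE 0 t HE Ht) as [c [Hc' Ec]].
assert (E0 : E 0 = 0).
{ unfold E; rewrite Rplus_0_r.
  rewrite (RInt_point (V := R_CompleteNormedModule)); unfold zero; simpl; ring. }
rewrite E0 in Ec; fold (E t).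
replace (E t) with (dE c * t) by lra.
(* Here [dE c] is half of g (a + c) - g a - c g1 (a + c). One mean value replaces the increment of
   [g] by c g1 d, a second one the difference of [g1] at [d] and [a + c] by a value of [g2]. *)
destruct (MVT' g g1 a (a + c) H1) as [d [Hd Ed]]; [lra|].
destruct (MVT' g1 g2 d (a + c) H2) as [e [He Ee]]; [lra|].
assert (Hdc : dE c = - (g2 e * ((a + c - d) * (c / 2)))).
{ unfold dE; replace (g (a + c)) with (g a + g1 d * (a + c - a)) by lra.
  replace (g1 (a + c)) with (g1 d + g2 e * (a + c - d)) by lra.
  field. }
rewrite Hdc, Rabs_mult, Rabs_Ropp, Rabs_mult, (Rabs_right t) by lra.
rewrite (Rabs_right ((a + c - d) * (c / 2))) by (apply Rle_ge, Rmult_le_pos; lra).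
assert (0 <= M) by (apply Rle_trans with (2 := HM 0), Rabs_pos).
assert ((a + c - d) * (c / 2) <= t * (t / 2)) by (apply Rmult_le_compat; lra).
assert (0 <= (a + c - d) * (c / 2)) by (apply Rmult_le_pos; lra).
replace (M / 2 * t ^ 3) with ((M * (t * (t / 2))) * t) by field.
apply Rmult_le_compat_r; auto.
apply Rmult_le_compat; auto using Rabs_pos.
Qed.

Lemma trapezoid_rule (g g1 g2 : R -> R) (M : R) (n : nat) :
  (forall x, is_derive g x (g1 x)) -> (forall x, is_derive g1 x (g2 x)) ->
  (forall x, Rabs (g2 x) <= M) ->
  Rabs (RInt g 0 1 -
        / INR (S n) * (g 0 / 2 + sum1 (fun i => g (INR i / INR (S n))) n + g 1 / 2))
  <= M / 2 / INR (S n) ^ 2.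
Proof.
intros H1 H2 HM.
assert (Hc : forall x, continuous g x).
{ intros x; apply (is_derive_continuous _ _ _ (H1 x)). }
set (N := INR (S n)).
assert (HN : 0 < N) by (apply lt_0_INR; lia).
(* Induction over the panels: on the first [S m] of them the error is at most [S m] times that of a
   single panel of length 1/N. *)
assert (Hm : forall m, Rabs (RInt g 0 (INR (S m) / N) -
    / N * (g 0 / 2 + sum1 (fun i => g (INR i / N)) m + g (INR (S m) / N) / 2))
    <= INR (S m) * (M / 2 * (/ N) ^ 3)).
{ induction m as [|m IH].
  - rewrite sum1_0.
    assert (H := trapezoid_one g g1 g2 M 0 (/ N) H1 H2 HM).
    rewrite Rplus_0_l in H.
    replace (INR 1 / N) with (/ N) by (simpl; field; lra).
    simpl (INR 1); rewrite Rmult_1_l.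
    replace (g 0 / 2 + 0 + g (/ N) / 2) with ((g 0 + g (/ N)) / 2) by lra.
    apply H; left; apply Rinv_0_lt_compat; auto.
  - assert (H := trapezoid_one g g1 g2 M (INR (S m) / N) (/ N) H1 H2 HM).
    replace (INR (S m) / N + / N) with (INR (S (S m)) / N) in H
      by (rewrite (S_INR (S m)); field; lra).
    rewrite (RInt_split g _ (INR (S m) / N)) by exact Hc.
    rewrite sum1_S, (S_INR (S m)).
    eapply Rle_trans; [| rewrite Rmult_plus_distr_r; apply Rplus_le_compat;
       [exact IH | rewrite Rmult_1_l; apply H; left; apply Rinv_0_lt_compat; auto]].
    eapply Rle_trans; [| apply Rabs_triang].
    rewrite (S_INR (S m)).
    right; f_equal; field; lra. }
specialize (Hm n); fold N in Hm.
replace (N / N) with 1 in Hm by (field; lra).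
replace (M / 2 / N ^ 2) with (N * (M / 2 * (/ N) ^ 3)) by (field; lra).
exact Hm.
Qed.

(** * Trapezoidal sums of cosine transforms *)

(** The trapezoidal sum with step 1/n for [cos_transform f y]. The node 0 has half weight, hence no
    factor 2; the node 1 is left out because the functions it is applied to vanish there. *)
Definition cos_sum (f : R -> R) (n : nat) (y : R) : R :=
  / INR n * (f 0 + 2 * sum1 (fun i =>
    f (INR i / INR n) * cos (2 * PI * (INR i / INR n * y))) (pred n)).

Definition cos_transform (f : R -> R) (y : R) : R :=
  2 * RInt (fun x => f x * cos (2 * PI * (x * y))) 0 1.

Definition cos_sum_prim (f : R -> R) (n : nat) (y : R) : R :=
  / INR n * (f 0 * y + 2 * sum1 (fun i => f (INR i / INR n) *
    (sin (2 * PI * (INR i / INR n * y)) / (2 * PI * (INR i / INR n)))) (pred n)).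

(** For 0 <= x < 1, [sigma k x] is [PI / q k] times [wave (q k) x]. The bound variable [q] is a
    number and hides the function [q]. *)
Definition wave (q x : R) : R := sin (2 * PI * (q * (1 - x))).

Lemma frac_pos (i n : nat) : (1 <= i)%nat -> (0 < n)%nat -> 0 < INR i / INR n.
Proof. intros; apply Rdiv_lt_0_compat; apply lt_0_INR; lia. Qed.

Lemma is_derive_cos_sum_prim (f : R -> R) (n : nat) (y : R) :
  (0 < n)%nat -> is_derive (cos_sum_prim f n) y (cos_sum f n y).
Proof.
intros Hn; unfold cos_sum_prim, cos_sum.
apply (is_derive_scal (fun y => f 0 * y + 2 * sum1 (fun i => f (INR i / INR n) *
    (sin (2 * PI * (INR i / INR n * y)) / (2 * PI * (INR i / INR n)))) (pred n))).
apply (is_derive_plus (K := R_AbsRing) (V := R_NormedModule) (fun y => f 0 * y)).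
- auto_derive; auto; ring.
- apply is_derive_scal.
  apply (is_derive_sum1 (fun i y => f (INR i / INR n) *
    (sin (2 * PI * (INR i / INR n * y)) / (2 * PI * (INR i / INR n))))).
  intros i Hi; assert (H := frac_pos i n (proj1 Hi) Hn); assert (HP := PI_RGT_0).
  set (u := INR i / INR n) in *; auto_derive; auto; field; lra.
Qed.

Lemma continuous_cos_sum (f : R -> R) (n : nat) (y : R) :
  (0 < n)%nat -> continuous (cos_sum f n) y.
Proof.
intros Hn; unfold cos_sum.
set (c := fun i => f (INR i / INR n)).
assert (H : is_derive (fun y => / INR n * (f 0 + 2 * sum1 (fun i =>
    c i * cos (2 * PI * (INR i / INR n * y))) (pred n))) y (/ INR n * (0 + 2 *
    sum1 (fun i => c i * - ((2 * PI * (INR i / INR n)) *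
      sin (2 * PI * (INR i / INR n * y)))) (pred n)))).
{ apply (is_derive_scal (fun y => f 0 + 2 * sum1 (fun i =>
    c i * cos (2 * PI * (INR i / INR n * y))) (pred n))).
  apply (is_derive_plus (K := R_AbsRing) (V := R_NormedModule) (fun _ => f 0)).
  - apply (is_derive_const (K := R_AbsRing) (V := R_NormedModule)).
  - apply is_derive_scal.
    apply (is_derive_sum1 (fun i y => c i * cos (2 * PI * (INR i / INR n * y)))).
    intros i Hi; auto_derive; auto; ring. }
apply (is_derive_continuous _ _ _ H).
Qed.

Lemma RInt_cos_sum (f : R -> R) (n : nat) (a b : R) :
  (0 < n)%nat -> RInt (cos_sum f n) a b = cos_sum_prim f n b - cos_sum_prim f n a.
Proof.
intros Hn; apply (is_RInt_unique (V := R_CompleteNormedModule)).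
apply (is_RInt_derive (V := R_CompleteNormedModule) (cos_sum_prim f n)); intros x _.
- apply is_derive_cos_sum_prim, Hn.
- apply continuous_cos_sum, Hn.
Qed.

Lemma cos_sum_prim_0 (f : R -> R) (n : nat) : cos_sum_prim f n 0 = 0.
Proof.
unfold cos_sum_prim.
rewrite (sum1_ext _ (fun i => 0 * 0)).
- rewrite sum1_mult_l; ring.
- intros i _; rewrite !Rmult_0_r, sin_0; unfold Rdiv; ring.
Qed.

(* The points [m/2 + 1/4] are the zeros of [cos (2 PI y)]: for an antiderivative [g]
   with [g 0 = 0], [alt_sum g n] is the integral of [g'] against the sign of that cosine,
   up to the contribution of the last endpoint. *)
Fixpoint alt_sum (g : R -> R) (n : nat) : R :=
  match n with
  | 0 => 0
  | S m => alt_sum g m + 2 * ((-1) ^ m * g (INR m / 2 + 1 / 4))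
  end.

Lemma alt_sum_S (g : R -> R) (n : nat) :
  alt_sum g (S n) = alt_sum g n + 2 * ((-1) ^ n * g (INR n / 2 + 1 / 4)).
Proof. reflexivity. Qed.

Lemma alt_sum_ext (f g : R -> R) (n : nat) :
  (forall y, f y = g y) -> alt_sum f n = alt_sum g n.
Proof.
intros H; induction n as [|n IH]; [reflexivity|].
rewrite !alt_sum_S, IH, H; reflexivity.
Qed.

Lemma alt_sum_lin (a b : R) (f g : R -> R) (n : nat) :
  alt_sum (fun y => a * f y + b * g y) n = a * alt_sum f n + b * alt_sum g n.
Proof. induction n as [|n IH]; [simpl; ring | rewrite !alt_sum_S, IH; ring]. Qed.

Lemma alt_sum_sum1 (c : nat -> R) (f : nat -> R -> R) (m n : nat) :
  alt_sum (fun y => sum1 (fun i => c i * f i y) m) n =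
  sum1 (fun i => c i * alt_sum (f i) n) m.
Proof.
induction m as [|m IH].
- rewrite sum1_0; induction n as [|n IH]; [reflexivity|].
  rewrite alt_sum_S, IH, sum1_0; ring.
- rewrite sum1_S, <- IH.
  rewrite (alt_sum_ext _ (fun y => 1 * sum1 (fun i => c i * f i y) m + c (S m) * f (S m) y)).
  + rewrite alt_sum_lin; ring.
  + intros y; rewrite sum1_S; ring.
Qed.

(** Constants are orthogonal to the sign of cos (2 PI y) on [0, n/2]; the second summand is the
    contribution of the endpoint n/2. *)
Lemma alt_sum_id (n : nat) : alt_sum (fun y => y) n + (-1) ^ n * (INR n / 2) = 0.
Proof.
induction n as [|n IH]; [simpl; lra|].
rewrite alt_sum_S, S_INR; simpl ((-1) ^ S n); lra.
Qed.

(** Since 2 cos (t/4) sin (t (m/2 + 1/4)) = sin (t (m+1)/2) + sin (t m/2), the alternating sum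
    telescopes once multiplied by cos (t/4). *)
Lemma alt_sum_sin (t : R) (n : nat) :
  cos (t / 4) * alt_sum (fun y => sin (t * y)) n = - ((-1) ^ n * sin (t * (INR n / 2))).
Proof.
induction n as [|n IH]; [simpl; rewrite Rdiv_0_l, !Rmult_0_r, sin_0; ring|].
rewrite alt_sum_S, Rmult_plus_distr_l, IH, S_INR; simpl ((-1) ^ S n).
set (v := t * (INR n / 2 + 1 / 4)).
replace (t * (INR n / 2)) with (v - t / 4) by (unfold v; field).
replace (t * ((INR n + 1) / 2)) with (v + t / 4) by (unfold v; field).
rewrite sin_minus, sin_plus; ring.
Qed.

(* In the variable [x = y/n], [cos_sum f n] only has frequencies smaller than [n],
   while the sign of [cos (2 PI y)] has frequencies [n], [3 n], [5 n], etc. *)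
Lemma alt_sum_prim (f : R -> R) (n : nat) : (0 < n)%nat ->
  alt_sum (cos_sum_prim f n) n + (-1) ^ n * cos_sum_prim f n (INR n / 2) = 0.
Proof.
intros Hn.
assert (HN : 0 < INR n) by (apply lt_0_INR; lia).
assert (HP := PI_RGT_0).
set (g := fun i y => sin (2 * PI * (INR i / INR n) * y)).
set (c := fun i => f (INR i / INR n) / (2 * PI * (INR i / INR n))).
assert (E : forall y, cos_sum_prim f n y =
  / INR n * f 0 * y + / INR n * 2 * sum1 (fun i => c i * g i y) (pred n)).
{ intros y; unfold cos_sum_prim.
  rewrite (sum1_ext _ (fun i => c i * g i y)); [ring|].
  intros i _; unfold c, g; rewrite !Rmult_assoc; unfold Rdiv; ring. }
rewrite (alt_sum_ext _ _ n E), alt_sum_lin, (alt_sum_sum1 c g), E.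
rewrite (sum1_ext (fun i => c i * alt_sum (g i) n) (fun i => 0 * 0)).
2: { intros i Hi.
  enough (Hs : alt_sum (g i) n = 0) by (rewrite Hs; ring).
  (* For t = 2 PI i/n the right-hand side contains sin (i PI) = 0, and 0 < i < n puts t/4 strictly
     between 0 and PI/2, so the factor cos (t/4) can be cancelled. *)
  assert (H := alt_sum_sin (2 * PI * (INR i / INR n)) n).
  replace (2 * PI * (INR i / INR n) * (INR n / 2)) with (INR i * PI) in H
    by (field; lra).
  rewrite (sin_eq_0_1 (INR i * PI)) in H
    by (exists (Z.of_nat i); rewrite INR_IZR_INZ; reflexivity).
  rewrite Rmult_0_r, Ropp_0 in H.
  apply Rmult_integral in H; destruct H as [H|H]; [exfalso|exact H].
  assert (Hi0 := frac_pos i n (proj1 Hi) Hn).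
  assert (Hi1 : INR i / INR n < 1).
  { apply Rmult_lt_reg_r with (INR n); auto; unfold Rdiv.
    rewrite Rmult_assoc, Rinv_l, Rmult_1_r, Rmult_1_l by lra.
    apply lt_INR; lia. }
  revert H; apply Rgt_not_eq, cos_gt_0.
  - assert (0 < PI * (INR i / INR n)) by (apply Rmult_lt_0_compat; auto); lra.
  - assert (PI * (INR i / INR n) < PI * 1) by (apply Rmult_lt_compat_l; auto); lra. }
rewrite (sum1_ext (fun i => c i * g i (INR n / 2)) (fun i => 0 * 0)).
2: { intros i _; unfold g.
  replace (2 * PI * (INR i / INR n) * (INR n / 2)) with (INR i * PI) by (field; lra).
  rewrite (sin_eq_0_1 (INR i * PI)); [ring|].
  exists (Z.of_nat i); rewrite INR_IZR_INZ; reflexivity. }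
rewrite sum1_mult_l.
assert (H := alt_sum_id n).
replace (alt_sum (fun y => y) n) with (- ((-1) ^ n * (INR n / 2))) by lra; ring.
Qed.

(** * Waves against cosines: discretization error and closed forms *)

Lemma is_derive_wave_cos (q y x : R) :
  is_derive (fun x => wave q x * cos (2 * PI * (x * y))) x
    (- (2 * PI * q) * cos (2 * PI * (q * (1 - x))) * cos (2 * PI * (x * y)) -
     2 * PI * y * (wave q x * sin (2 * PI * (x * y)))).
Proof. unfold wave; auto_derive; auto; unfold Rminus; ring. Qed.

(** With a = 2 PI q and b = 2 PI y, the second derivative is grouped into two products of modulus at
    most 1 with coefficients of modulus a^2 + b^2 and 2ab; for nonnegative q and y this gives the
    bound (a + b)^2. *)
Lemma is_derive2_wave_cos (q y x : R) :
  is_derive (fun x =>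
     - (2 * PI * q) * cos (2 * PI * (q * (1 - x))) * cos (2 * PI * (x * y)) -
     2 * PI * y * (wave q x * sin (2 * PI * (x * y)))) x
    (- ((2 * PI * q) ^ 2 + (2 * PI * y) ^ 2) * (wave q x * cos (2 * PI * (x * y))) +
     2 * (2 * PI * q) * (2 * PI * y) *
       (cos (2 * PI * (q * (1 - x))) * sin (2 * PI * (x * y)))).
Proof. unfold wave; auto_derive; auto; unfold Rminus; ring. Qed.

Lemma continuous_wave_cos (q y x : R) :
  continuous (fun x => wave q x * cos (2 * PI * (x * y))) x.
Proof. apply (is_derive_continuous _ _ _ (is_derive_wave_cos q y x)). Qed.

Lemma Rabs_sin_le (x : R) : Rabs (sin x) <= 1.
Proof. apply Rabs_le, SIN_bound. Qed.

Lemma Rabs_cos_le (x : R) : Rabs (cos x) <= 1.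
Proof. apply Rabs_le, COS_bound. Qed.

Lemma Rabs_mult_le_1 (x y : R) : Rabs x <= 1 -> Rabs y <= 1 -> Rabs (x * y) <= 1.
Proof.
intros Hx Hy; rewrite Rabs_mult, <- (Rmult_1_l 1).
apply Rmult_le_compat; auto using Rabs_pos.
Qed.

Lemma wave_1 (q : R) : wave q 1 = 0.
Proof. unfold wave; rewrite <- sin_0; f_equal; ring. Qed.

Lemma cos_sum_wave_error (q y : R) (n : nat) : 0 <= q -> 0 <= y -> (0 < n)%nat ->
  Rabs (cos_sum (wave q) n y - cos_transform (wave q) y) <= (2 * PI * (q + y)) ^ 2 / INR n ^ 2.
Proof.
intros Hq Hy Hn; destruct n as [|n]; [lia|].
assert (HP := PI_RGT_0).
assert (H := trapezoid_rule _ _ _ ((2 * PI * (q + y)) ^ 2) n (is_derive_wave_cos q y)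
  (is_derive2_wave_cos q y)).
assert (HN : 0 < INR (S n)) by (apply lt_0_INR; lia).
(* The end terms of the trapezoidal rule become [wave q 0 / 2] and 0. Doubling then yields
   [cos_sum], and removes the 1/2 from the error bound. *)
cbv beta in H; rewrite wave_1, Rmult_0_l, Rmult_0_l, Rmult_0_r, cos_0, Rmult_1_r in H.
unfold cos_sum, cos_transform; simpl pred.
set (I := RInt _ 0 1) in *; set (N := INR (S n)) in *; set (s := sum1 _ n) in *.
replace (/ N * (wave q 0 + 2 * s) - 2 * I) with
  (- 2 * (I - / N * (wave q 0 / 2 + s + 0 / 2))) by (field; lra).
rewrite Rabs_mult, Rabs_left by lra.
replace ((2 * PI * (q + y)) ^ 2 / N ^ 2) with
  (- (-2) * ((2 * PI * (q + y)) ^ 2 / 2 / N ^ 2)) by (field; lra).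
apply Rmult_le_compat_l; [lra|]; apply H; intros x.
set (a := 2 * PI * q); set (b := 2 * PI * y).
assert (0 <= a) by (unfold a; apply Rmult_le_pos; lra).
assert (0 <= b) by (unfold b; apply Rmult_le_pos; lra).
assert (0 <= a * b) by (apply Rmult_le_pos; auto).
replace ((2 * PI * (q + y)) ^ 2) with ((a + b) ^ 2) by (unfold a, b; ring).
assert (A1 : Rabs (wave q x * cos (2 * PI * (x * y))) <= 1)
  by (apply Rabs_mult_le_1; [apply Rabs_sin_le | apply Rabs_cos_le]).
assert (A2 : Rabs (cos (2 * PI * (q * (1 - x))) * sin (2 * PI * (x * y))) <= 1)
  by (apply Rabs_mult_le_1; [apply Rabs_cos_le | apply Rabs_sin_le]).
apply Rabs_le_between in A1; apply Rabs_le_between in A2; apply Rabs_le.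
split; nra.
Qed.

(** Both factors of the integrand are harmonic oscillations in x, so their Wronskian [W] has
    derivative 4 PI^2 (y^2 - q^2) times the integrand. The condition on [q] makes [W 0] vanish. The
    multiplied form avoids a division at y = q. *)
Lemma cos_transform_wave (q y : R) : cos (2 * PI * q) = 0 ->
  (q ^ 2 - y ^ 2) * cos_transform (wave q) y = q / PI * cos (2 * PI * y).
Proof.
intros Hq; assert (HP := PI_RGT_0).
set (W := fun x => - (2 * PI * q) * cos (2 * PI * (q * (1 - x))) * cos (2 * PI * (x * y))
  + 2 * PI * y * (wave q x * sin (2 * PI * (x * y)))).
assert (H : is_RInt (fun x => 4 * PI ^ 2 * (y ^ 2 - q ^ 2) * (wave q x * cos (2 * PI * (x * y))))
  0 1 (W 1 - W 0)).
{ apply (is_RInt_derive (V := R_CompleteNormedModule) W); intros x _.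
  - unfold W, wave; auto_derive; auto; unfold Rminus; ring.
  - apply (continuous_scal_r (K := R_AbsRing) (V := R_NormedModule)), continuous_wave_cos. }
apply (is_RInt_unique (V := R_CompleteNormedModule)) in H.
rewrite (RInt_scal (V := R_CompleteNormedModule) (fun x => wave q x * cos (2 * PI * (x * y))))
  in H by (apply ex_RInt_of_continuous, continuous_wave_cos).
change (4 * PI ^ 2 * (y ^ 2 - q ^ 2) * RInt (fun x => wave q x * cos (2 * PI * (x * y))) 0 1
  = W 1 - W 0) in H.
unfold cos_transform; set (I := RInt _ 0 1) in *.
unfold W in H; rewrite wave_1 in H.
replace (2 * PI * (q * (1 - 1))) with 0 in H by ring.
replace (2 * PI * (q * (1 - 0))) with (2 * PI * q) in H by ring.
replace (2 * PI * (0 * y)) with 0 in H by ring.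
replace (2 * PI * (1 * y)) with (2 * PI * y) in H by ring.
rewrite Hq, cos_0, sin_0 in H.
apply Rmult_eq_reg_l with (2 * PI ^ 2); [|apply Rgt_not_eq; nra].
replace (2 * PI ^ 2 * ((q ^ 2 - y ^ 2) * (2 * I))) with
  (- (4 * PI ^ 2 * (y ^ 2 - q ^ 2) * I)) by ring.
rewrite H; field; lra.
Qed.

Lemma Rabs_cos_minus_le (a b : R) : Rabs (cos a - cos b) <= Rabs (a - b).
Proof.
destruct (MVT_gen cos b a (fun x => - sin x)) as [c [_ E]].
- intros x _; apply is_derive_Reals, derivable_pt_lim_cos.
- intros x _; apply continuity_pt_filterlim, continuous_cos.
- rewrite E, Rabs_mult, Rabs_Ropp.
  rewrite <- (Rmult_1_l (Rabs (a - b))) at 2.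
  apply Rmult_le_compat_r; [apply Rabs_pos | apply Rabs_sin_le].
Qed.

(** Gives continuity at every point, including y = q, where [cos_transform_wave] carries no
    information about the value. *)
Lemma cos_transform_wave_lipschitz (q y y' : R) :
  Rabs (cos_transform (wave q) y - cos_transform (wave q) y') <= 4 * PI * Rabs (y - y').
Proof.
assert (HP := PI_RGT_0); unfold cos_transform.
rewrite <- Rmult_minus_distr_l, Rabs_mult, (Rabs_right 2) by lra.
replace (4 * PI * Rabs (y - y')) with
  (2 * ((1 - 0) * (2 * PI * Rabs (y - y')))) by ring.
apply Rmult_le_compat_l; [lra|].
apply RInt_approx; [lra | apply continuous_wave_cos | apply continuous_wave_cos |].
intros x Hx.
rewrite <- Rmult_minus_distr_l, Rabs_mult.
rewrite <- (Rmult_1_l (2 * PI * Rabs (y - y'))).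
apply Rmult_le_compat; auto using Rabs_pos; [apply Rabs_sin_le|].
apply Rle_trans with (1 := Rabs_cos_minus_le _ _).
replace (2 * PI * (x * y) - 2 * PI * (x * y')) with (2 * PI * x * (y - y')) by ring.
rewrite Rabs_mult; apply Rmult_le_compat_r; [apply Rabs_pos|].
rewrite Rabs_right by (apply Rle_ge, Rmult_le_pos; lra).
nra.
Qed.

Lemma continuous_cos_transform_wave (q y : R) : continuous (cos_transform (wave q)) y.
Proof.
assert (HP := PI_RGT_0).
apply continuity_pt_filterlim; intros e He.
exists (e / (4 * PI)); split; [apply Rdiv_lt_0_compat; lra|].
intros x [_ Hx]; simpl in *; unfold R_dist in *.
apply Rle_lt_trans with (1 := cos_transform_wave_lipschitz q x y).
apply Rmult_lt_reg_l with (/ (4 * PI)); [apply Rinv_0_lt_compat; lra|].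
rewrite <- Rmult_assoc, Rinv_l, Rmult_1_l by lra.
rewrite (Rmult_comm _ e); exact Hx.
Qed.

(* Christoffel-Darboux type telescoping: both factors solve a three-term
   recurrence, so the sum is a discrete Wronskian. *)
Lemma sin_cos_sum (al th : R) (N m : nat) :
  2 * (cos th - cos al) * sum1 (fun i => sin (al * (INR N - INR i)) * cos (INR i * th)) m =
  sin (al * (INR N - 1)) - sin (al * INR N) * cos th -
  (sin (al * (INR N - INR (S m))) * cos (INR m * th) -
   sin (al * (INR N - INR m)) * cos (INR (S m) * th)).
Proof.
induction m as [|m IH].
- rewrite sum1_0; simpl INR.
  rewrite Rmult_0_l, cos_0, Rmult_1_l, Rminus_0_r; ring.
- rewrite sum1_S, Rmult_plus_distr_l, IH.
  set (u := al * (INR N - INR (S m))); set (v := INR (S m) * th).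
  replace (al * (INR N - INR (S (S m)))) with (u - al)
    by (unfold u; rewrite (S_INR (S m)); ring).
  replace (al * (INR N - INR m)) with (u + al) by (unfold u; rewrite (S_INR m); ring).
  replace (INR (S (S m)) * th) with (v + th) by (unfold v; rewrite (S_INR (S m)); ring).
  replace (INR m * th) with (v - th) by (unfold v; rewrite (S_INR m); ring).
  rewrite sin_minus, sin_plus, cos_minus, cos_plus; ring.
Qed.

(** The discrete counterpart of [cos_transform_wave]. In [sin_cos_sum], summed up to n - 1, the
    Wronskian at 0 cancels against the half-weighted node 0, since cos (2 PI q) = 0; at the other
    end one product survives because the wave vanishes at 1. *)
Lemma cos_sum_wave (q y : R) (n : nat) : (0 < n)%nat -> cos (2 * PI * q) = 0 ->
  (cos (2 * PI * (y / INR n)) - cos (2 * PI * (q / INR n))) * (INR n * cos_sum (wave q) n y) =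
  sin (2 * PI * (q / INR n)) * cos (2 * PI * y).
Proof.
intros Hn Hq; destruct n as [|n]; [lia|].
assert (HN : 0 < INR (S n)) by (apply lt_0_INR; lia).
unfold cos_sum; simpl pred.
set (al := 2 * PI * (q / INR (S n))); set (th := 2 * PI * (y / INR (S n))).
assert (H := sin_cos_sum al th (S n) n).
rewrite (sum1_ext (fun i => wave q (INR i / INR (S n)) * cos (2 * PI * (INR i / INR (S n) * y)))
  (fun i => sin (al * (INR (S n) - INR i)) * cos (INR i * th))).
2: { intros i _; unfold wave, al, th; f_equal; f_equal; field; lra. }
rewrite <- (Rmult_assoc (INR (S n)) (/ _)), Rinv_r, Rmult_1_l by lra.
set (s := sum1 _ n) in *.
rewrite Rmult_plus_distr_l.
replace ((cos th - cos al) * (2 * s)) with (2 * (cos th - cos al) * s) by ring.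
rewrite H.
replace (al * (INR (S n) - 1)) with (2 * PI * q - al) by (unfold al; field; lra).
replace (al * (INR (S n) - INR (S n))) with 0 by ring.
replace (al * (INR (S n) - INR n)) with al by (rewrite S_INR; ring).
replace (al * INR (S n)) with (2 * PI * q) by (unfold al; field; lra).
replace (INR (S n) * th) with (2 * PI * y) by (unfold th; field; lra).
replace (wave q 0) with (sin (2 * PI * q)) by (unfold wave; f_equal; ring).
rewrite sin_minus, Hq, sin_0; ring.
Qed.

(** * The function phi and its transform *)

(* [amp1], [amp2], [amp3] are the values [omega_k z1 z2 k (q k)]; the factors
   [4 PI], [4/3 PI], [4/5 PI] of [phi_comb] are [PI / q k]. *)
Definition amp1 (z1 z2 : R) : R := 4 / 3 * ((z1 ^ 2 - 1 / 16) * (z2 ^ 2 - 1 / 16)).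
Definition amp2 (z1 z2 : R) : R := - 2 * ((z1 ^ 2 - 9 / 16) * (z2 ^ 2 - 9 / 16)).
Definition amp3 (z1 z2 : R) : R := 2 / 3 * ((z1 ^ 2 - 25 / 16) * (z2 ^ 2 - 25 / 16)).

(** A function of three numbers, so that the same combination can be taken of the waves, their
    transforms, their sums and their integrals. *)
Definition phi_comb (z1 z2 u1 u2 u3 : R) : R :=
  amp1 z1 z2 * (4 * PI) * u1 + amp2 z1 z2 * (4 / 3 * PI) * u2 +
  amp3 z1 z2 * (4 / 5 * PI) * u3.

Definition phi_half (z1 z2 x : R) : R :=
  phi_comb z1 z2 (wave (1 / 4) x) (wave (3 / 4) x) (wave (5 / 4) x).

Definition phi_hat (z1 z2 y : R) : R :=
  phi_comb z1 z2 (cos_transform (wave (1 / 4)) y) (cos_transform (wave (3 / 4)) y) (cos_transform (wave (5 / 4)) y).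

Lemma phi_in_half (z1 z2 x : R) : phi_in z1 z2 x = phi_half z1 z2 (Rabs x).
Proof.
unfold phi_in; rewrite !sum_Sn_m, sum_n_m_zero by lia.
change (@plus R_AbelianMonoid) with Rplus; change (@zero R_AbelianMonoid) with 0.
unfold omega_k; cbn [List.filter Nat.eqb negb List.map List.fold_right].
replace (q 1) with (1 / 4) by (unfold q; simpl; field).
replace (q 2) with (3 / 4) by (unfold q; simpl; field).
replace (q 3) with (5 / 4) by (unfold q; simpl; field).
unfold phi_half, phi_comb, wave, amp1, amp2, amp3; field.
Qed.

Lemma phi_phi_half (z1 z2 x : R) : 0 <= x <= 1 -> phi z1 z2 x = phi_half z1 z2 x.
Proof.
intros [H0 [H1| ->]].
- rewrite phi_inE, phi_in_half, Rabs_right; [reflexivity | lra |].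
  apply Rabs_def1; lra.
- rewrite phi_out by (rewrite Rabs_R1; lra).
  unfold phi_half, phi_comb; rewrite !wave_1; ring.
Qed.

Lemma RInt_phi_comb (z1 z2 a b : R) (f1 f2 f3 : R -> R) :
  (forall x, continuous f1 x) -> (forall x, continuous f2 x) ->
  (forall x, continuous f3 x) ->
  RInt (fun x => phi_comb z1 z2 (f1 x) (f2 x) (f3 x)) a b =
  phi_comb z1 z2 (RInt f1 a b) (RInt f2 a b) (RInt f3 a b).
Proof.
intros H1 H2 H3; apply (is_RInt_unique (V := R_CompleteNormedModule)).
assert (Hs : forall c f, (forall x, continuous f x) ->
  is_RInt (fun x => c * f x) a b (c * RInt f a b)).
{ intros c f Hf; apply (is_RInt_scal (V := R_NormedModule)).
  apply (RInt_correct (V := R_CompleteNormedModule)), ex_RInt_of_continuous, Hf. }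
unfold phi_comb; apply (is_RInt_plus (V := R_NormedModule) (fun x => amp1 z1 z2 * (4 * PI) * f1 x +
  amp2 z1 z2 * (4 / 3 * PI) * f2 x)); [|auto].
apply (is_RInt_plus (V := R_NormedModule) (fun x => amp1 z1 z2 * (4 * PI) * f1 x)); auto.
Qed.

Lemma Re_phihat (z1 z2 y : R) : Re (phihat z1 z2 y) = phi_hat z1 z2 y.
Proof.
rewrite phihatE; simpl.
set (f := fun x => phi_in z1 z2 x * cos (2 * PI * (x * y))).
rewrite (RInt_ext _ f).
2: { intros x; rewrite Rmin_left, Rmax_right by lra; intros Hx; unfold f.
  rewrite phi_inE by (apply Rabs_def1; lra).
  rewrite <- cos_neg; f_equal; f_equal; ring. }
assert (E := RInt_even f 1); replace (Ropp 1) with (-1) in E by lra; rewrite E; clear E.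
- rewrite (RInt_ext _ (fun x => phi_comb z1 z2 (wave (1 / 4) x * cos (2 * PI * (x * y)))
    (wave (3 / 4) x * cos (2 * PI * (x * y))) (wave (5 / 4) x * cos (2 * PI * (x * y))))).
  + rewrite RInt_phi_comb by (apply continuous_wave_cos).
    unfold phi_hat, cos_transform, phi_comb; ring.
  + intros x; rewrite Rmin_left, Rmax_right by lra; intros Hx; unfold f.
    rewrite phi_in_half, Rabs_right by lra; unfold phi_half, phi_comb.
    match goal with |- ?a = ?b => change (@eq R a b) end; ring.
- intros x; apply (continuous_mult (K := R_AbsRing)); [apply continuous_phi_in|].
  apply (ex_derive_continuous (K := R_AbsRing) (V := R_NormedModule)); auto_derive; auto.
- intros x; unfold f; rewrite !phi_in_half, Rabs_Ropp.
  f_equal; rewrite <- cos_neg; f_equal; ring.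
Qed.

Lemma Re_scal_cexp (a t : R) : Re (Cmult (RtoC a) (cexp t)) = a * cos (2 * PI * t).
Proof. unfold cexp, RtoC, Cmult, Re; simpl; ring. Qed.

Lemma Im_scal_cexp (a t : R) : Im (Cmult (RtoC a) (cexp t)) = a * sin (2 * PI * t).
Proof. unfold cexp, RtoC, Cmult, Im; simpl; ring. Qed.

(** As [phi] is even, the terms for nu and - nu add up to a cosine, and their imaginary parts
    cancel. *)
Lemma F_cos_sum (z1 z2 : R) (n : nat) (x : R) : (0 < n)%nat ->
  F z1 z2 n x = RtoC (INR n * cos_sum (phi_half z1 z2) n (INR n * x)).
Proof.
intros Hn; destruct n as [|n]; [lia|].
assert (HN : 0 < INR (S n)) by (apply lt_0_INR; lia).
unfold F; rewrite sum_n_m_C; unfold RtoC; f_equal.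
- simpl Re.
  rewrite (sum_n_m_ext _ (fun j => (fun nu => phi z1 z2 (nu / INR (S n)) *
    cos (2 * PI * (nu * x))) (INR j - INR (S n)))).
  2: { intros j; apply Re_scal_cexp. }
  rewrite (sum_n_m_symmetric (fun nu => phi z1 z2 (nu / INR (S n)) *
    cos (2 * PI * (nu * x)))).
  unfold cos_sum; rewrite <- (Rmult_assoc (INR (S n)) (/ _)), Rinv_r, Rmult_1_l by lra; simpl pred.
  rewrite <- sum1_mult_l; f_equal.
  + rewrite Rdiv_0_l, Rmult_0_l, Rmult_0_r, cos_0, Rmult_1_r; apply phi_phi_half; lra.
  + apply sum1_ext; intros i Hi.
    replace (- INR i / INR (S n)) with (- (INR i / INR (S n))) by (field; lra).
    rewrite phi_even.
    replace (2 * PI * (- INR i * x)) with (- (2 * PI * (INR i * x))) by ring.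
    rewrite cos_neg, phi_phi_half.
    * replace (INR i / INR (S n) * (INR (S n) * x)) with (INR i * x) by (field; lra).
      ring.
    * split; [left; apply frac_pos; lia|].
      apply Rmult_le_reg_r with (INR (S n)); auto; unfold Rdiv.
      rewrite Rmult_assoc, Rinv_l, Rmult_1_r, Rmult_1_l by lra.
      apply le_INR; lia.
- rewrite (sum_n_m_ext _ (fun j => (fun nu => phi z1 z2 (nu / INR (S n)) *
    sin (2 * PI * (nu * x))) (INR j - INR (S n)))).
  2: { intros j; apply Im_scal_cexp. }
  rewrite (sum_n_m_symmetric (fun nu => phi z1 z2 (nu / INR (S n)) *
    sin (2 * PI * (nu * x)))).
  rewrite Rmult_0_l, Rmult_0_r, sin_0, Rmult_0_r, Rplus_0_l.
  rewrite (sum1_ext _ (fun i => 0 * 0)); [rewrite sum1_mult_l; apply Rmult_0_l|].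
  intros i Hi.
  replace (- INR i / INR (S n)) with (- (INR i / INR (S n))) by (field; lra).
  rewrite phi_even.
  replace (2 * PI * (- INR i * x)) with (- (2 * PI * (INR i * x))) by ring.
  rewrite sin_neg; ring.
Qed.

Lemma sum1_phi_comb (z1 z2 : R) (f1 f2 f3 : nat -> R) (m : nat) :
  sum1 (fun i => phi_comb z1 z2 (f1 i) (f2 i) (f3 i)) m =
  phi_comb z1 z2 (sum1 f1 m) (sum1 f2 m) (sum1 f3 m).
Proof. unfold phi_comb; rewrite !sum1_plus, !sum1_mult_l; reflexivity. Qed.

Lemma cos_sum_phi_half (z1 z2 : R) (n : nat) (y : R) :
  cos_sum (phi_half z1 z2) n y =
  phi_comb z1 z2 (cos_sum (wave (1 / 4)) n y) (cos_sum (wave (3 / 4)) n y) (cos_sum (wave (5 / 4)) n y).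
Proof.
unfold cos_sum.
rewrite (sum1_ext _ (fun i => phi_comb z1 z2
  (wave (1 / 4) (INR i / INR n) * cos (2 * PI * (INR i / INR n * y)))
  (wave (3 / 4) (INR i / INR n) * cos (2 * PI * (INR i / INR n * y)))
  (wave (5 / 4) (INR i / INR n) * cos (2 * PI * (INR i / INR n * y))))).
- rewrite sum1_phi_comb; unfold phi_half, phi_comb; ring.
- intros i _; unfold phi_half, phi_comb; ring.
Qed.

Lemma cos_q1 : cos (2 * PI * (1 / 4)) = 0.
Proof. rewrite <- cos_PI2; f_equal; field. Qed.

Lemma cos_q2 : cos (2 * PI * (3 / 4)) = 0.
Proof.
replace (2 * PI * (3 / 4)) with (PI / 2 + PI) by field.
rewrite neg_cos, cos_PI2; ring.
Qed.

Lemma cos_q3 : cos (2 * PI * (5 / 4)) = 0.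
Proof.
replace (2 * PI * (5 / 4)) with (PI / 2 + PI + PI) by field.
rewrite !neg_cos, cos_PI2; ring.
Qed.

(** The amplitudes are the partial fraction coefficients of [omega] in the variable y^2, so the
    three instances of [cos_transform_wave] recombine to omega y cos (2 PI y). With the denominator
    multiplied out the identity also holds at the poles. *)
Lemma phi_hat_closed (z1 z2 y : R) :
  (1 / 16 - y ^ 2) * (9 / 16 - y ^ 2) * (25 / 16 - y ^ 2) * phi_hat z1 z2 y =
  (z1 ^ 2 - y ^ 2) * (z2 ^ 2 - y ^ 2) * cos (2 * PI * y).
Proof.
assert (HP := PI_RGT_0).
assert (H1 := cos_transform_wave _ y cos_q1); assert (H2 := cos_transform_wave _ y cos_q2).
assert (H3 := cos_transform_wave _ y cos_q3).
unfold phi_hat, phi_comb.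
set (f1 := cos_transform (wave (1 / 4)) y) in *; set (f2 := cos_transform (wave (3 / 4)) y) in *.
set (f3 := cos_transform (wave (5 / 4)) y) in *.
replace ((1 / 4) ^ 2 - y ^ 2) with (1 / 16 - y ^ 2) in H1 by field.
replace ((3 / 4) ^ 2 - y ^ 2) with (9 / 16 - y ^ 2) in H2 by field.
replace ((5 / 4) ^ 2 - y ^ 2) with (25 / 16 - y ^ 2) in H3 by field.
transitivity (
  amp1 z1 z2 * (4 * PI) * (9 / 16 - y ^ 2) * (25 / 16 - y ^ 2) * ((1 / 16 - y ^ 2) * f1) +
  amp2 z1 z2 * (4 / 3 * PI) * (1 / 16 - y ^ 2) * (25 / 16 - y ^ 2) * ((9 / 16 - y ^ 2) * f2) +
  amp3 z1 z2 * (4 / 5 * PI) * (1 / 16 - y ^ 2) * (9 / 16 - y ^ 2) * ((25 / 16 - y ^ 2) * f3));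
  [ring|].
rewrite H1, H2, H3; unfold amp1, amp2, amp3; field; lra.
Qed.

Lemma continuous_phi_comb (z1 z2 x : R) (f1 f2 f3 : R -> R) :
  continuous f1 x -> continuous f2 x -> continuous f3 x ->
  continuous (fun x => phi_comb z1 z2 (f1 x) (f2 x) (f3 x)) x.
Proof.
intros H1 H2 H3; unfold phi_comb.
apply (continuous_plus (K := R_AbsRing) (V := R_NormedModule)
  (fun x => amp1 z1 z2 * (4 * PI) * f1 x + amp2 z1 z2 * (4 / 3 * PI) * f2 x)).
- apply (continuous_plus (K := R_AbsRing) (V := R_NormedModule));
  apply (continuous_scal_r (K := R_AbsRing) (V := R_NormedModule)); auto.
- apply (continuous_scal_r (K := R_AbsRing) (V := R_NormedModule)); auto.
Qed.

Lemma continuous_phi_hat (z1 z2 y : R) : continuous (phi_hat z1 z2) y.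
Proof. apply continuous_phi_comb; apply continuous_cos_transform_wave. Qed.

(** The factor (6 PI)^2 bounds (2 PI (q + y))^2 of [cos_sum_wave_error], as q + y <= 5/4 + 7/4 =
    3. *)
Definition error_const (z1 z2 : R) : R :=
  (Rabs (amp1 z1 z2 * (4 * PI)) + Rabs (amp2 z1 z2 * (4 / 3 * PI)) +
   Rabs (amp3 z1 z2 * (4 / 5 * PI))) * (6 * PI) ^ 2.

Lemma error_const_pos (z1 z2 : R) : 0 <= error_const z1 z2.
Proof.
apply Rmult_le_pos; [|apply pow2_ge_0].
assert (H1 := Rabs_pos (amp1 z1 z2 * (4 * PI))); assert (H2 := Rabs_pos (amp2 z1 z2 * (4 / 3 * PI))).
assert (H3 := Rabs_pos (amp3 z1 z2 * (4 / 5 * PI))); lra.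
Qed.

Lemma cos_sum_error (z1 z2 y : R) (n : nat) : (0 < n)%nat -> 0 <= y <= 7 / 4 ->
  Rabs (cos_sum (phi_half z1 z2) n y - phi_hat z1 z2 y) <= error_const z1 z2 / INR n ^ 2.
Proof.
intros Hn Hy; rewrite cos_sum_phi_half; unfold phi_hat, phi_comb, error_const.
assert (HN : 0 < INR n) by (apply lt_0_INR; lia).
assert (HP := PI_RGT_0).
assert (He : forall q, 0 <= q <= 5 / 4 ->
  Rabs (cos_sum (wave q) n y - cos_transform (wave q) y) <= (6 * PI) ^ 2 / INR n ^ 2).
{ intros q Hq; apply Rle_trans with (1 := cos_sum_wave_error q y n (proj1 Hq) (proj1 Hy) Hn).
  apply Rmult_le_compat_r; [left; apply Rinv_0_lt_compat, pow_lt, HN|].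
  apply pow_incr; split; [|nra].
  apply Rmult_le_pos; lra. }
set (c1 := amp1 z1 z2 * (4 * PI)); set (c2 := amp2 z1 z2 * (4 / 3 * PI)).
set (c3 := amp3 z1 z2 * (4 / 5 * PI)); set (B := (6 * PI) ^ 2) in *.
assert (H1 := He (1 / 4) ltac:(lra)); assert (H2 := He (3 / 4) ltac:(lra)).
assert (H3 := He (5 / 4) ltac:(lra)).
set (t1 := cos_sum (wave (1 / 4)) n y) in *; set (t2 := cos_sum (wave (3 / 4)) n y) in *.
set (t3 := cos_sum (wave (5 / 4)) n y) in *; set (f1 := cos_transform (wave (1 / 4)) y) in *.
set (f2 := cos_transform (wave (3 / 4)) y) in *; set (f3 := cos_transform (wave (5 / 4)) y) in *.
replace (c1 * t1 + c2 * t2 + c3 * t3 - (c1 * f1 + c2 * f2 + c3 * f3)) with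
  (c1 * (t1 - f1) + c2 * (t2 - f2) + c3 * (t3 - f3)) by ring.
replace ((Rabs c1 + Rabs c2 + Rabs c3) * B / INR n ^ 2) with
  (Rabs c1 * (B / INR n ^ 2) + Rabs c2 * (B / INR n ^ 2) + Rabs c3 * (B / INR n ^ 2))
  by (field; lra).
apply Rle_trans with (1 := Rabs_triang _ _), Rplus_le_compat.
- apply Rle_trans with (1 := Rabs_triang _ _), Rplus_le_compat;
  rewrite Rabs_mult; apply Rmult_le_compat_l; auto using Rabs_pos.
- rewrite Rabs_mult; apply Rmult_le_compat_l; auto using Rabs_pos.
Qed.

(** * Signs *)

Lemma is_lim_seq_n_sin (t : R) : 0 < t ->
  is_lim_seq (fun n => INR n * sin (t / INR n)) t.
Proof.
intros Ht.
assert (Hinv : is_lim_seq (fun n => t / INR n) 0).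
{ assert (H := is_lim_seq_scal_l _ t _ (is_lim_seq_inv _ _ is_lim_seq_INR ltac:(discriminate))).
  simpl in H; rewrite Rmult_0_r in H; exact H. }
assert (H := is_lim_comp_seq _ (fun n => t / INR n) 0 1 is_lim_sinc_0).
assert (Hne : eventually (fun n => Finite (t / INR n) <> Finite 0)).
{ exists 1%nat; intros n Hn E; injection E as E.
  assert (0 < t / INR n) by (apply Rdiv_lt_0_compat; auto; apply lt_0_INR; lia); lra. }
specialize (H Hne Hinv).
apply (is_lim_seq_scal_l _ t) in H; simpl in H; rewrite Rmult_1_r in H.
apply is_lim_seq_ext_loc with (2 := H).
exists 1%nat; intros n Hn.
assert (0 < INR n) by (apply lt_0_INR; lia).
field; lra.
Qed.

(** The squared chord of an arc of length y on a circle of circumference n, that is (n sin (PI y/n)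
    / PI)^2. It replaces y^2 in the discrete formulas and tends to it. *)
Definition chord (n : nat) (y : R) : R :=
  INR n ^ 2 * (1 - cos (2 * PI * (y / INR n))) / (2 * PI ^ 2).

Definition sine_ratio (n : nat) (y : R) : R :=
  INR n * sin (2 * PI * (y / INR n)) / (2 * PI * y).

Lemma is_lim_seq_chord (y : R) : 0 < y -> is_lim_seq (fun n => chord n y) (y ^ 2).
Proof.
intros Hy; assert (HP := PI_RGT_0).
assert (H := is_lim_seq_n_sin (PI * y) ltac:(nra)).
assert (H2 := is_lim_seq_scal_l _ (/ PI ^ 2) _ (is_lim_seq_mult' _ _ _ _ H H)).
simpl in H2.
replace (/ (PI * (PI * 1)) * (PI * y * (PI * y))) with (y ^ 2) in H2 by (field; lra).
apply is_lim_seq_ext with (2 := H2); intros n; unfold chord.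
replace (2 * PI * (y / INR n)) with (2 * (PI * y / INR n)) by (unfold Rdiv; ring).
rewrite cos_2a_sin; field; lra.
Qed.

Lemma is_lim_seq_sine_ratio (y : R) : 0 < y -> is_lim_seq (fun n => sine_ratio n y) 1.
Proof.
intros Hy; assert (HP := PI_RGT_0).
assert (Hp : 0 < 2 * PI * y) by nra.
assert (H := is_lim_seq_scal_l _ (/ (2 * PI * y)) _ (is_lim_seq_n_sin _ Hp)).
simpl in H; rewrite Rinv_l in H by lra.
apply is_lim_seq_ext with (2 := H); intros n; unfold sine_ratio.
replace (2 * PI * (y / INR n)) with (2 * PI * y / INR n) by (unfold Rdiv; ring).
field; lra.
Qed.

(** [cos_sum_wave] rescaled so that all its factors converge as n grows; replacing [chord] and
    [sine_ratio] by their limits gives [cos_transform_wave] up to sign. *)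
Lemma cos_sum_wave_chord (q y : R) (n : nat) : (0 < n)%nat -> 0 < q -> cos (2 * PI * q) = 0 ->
  (chord n y - chord n q) * cos_sum (wave q) n y = - (q / PI * sine_ratio n q * cos (2 * PI * y)).
Proof.
intros Hn Hq Hc; assert (HP := PI_RGT_0).
assert (HN : 0 < INR n) by (apply lt_0_INR; lia).
assert (H := cos_sum_wave q y n Hn Hc).
unfold sine_ratio.
replace (q / PI * (INR n * sin (2 * PI * (q / INR n)) / (2 * PI * q)) * cos (2 * PI * y))
  with (INR n / (2 * PI ^ 2) * (sin (2 * PI * (q / INR n)) * cos (2 * PI * y)))
  by (field; lra).
rewrite <- H; unfold chord; field; lra.
Qed.

Lemma eventually_gt (u : nat -> R) (l c : R) :
  is_lim_seq u l -> c < l -> eventually (fun n => c < u n).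
Proof. intros H Hc; apply H; apply (open_gt c l Hc). Qed.

(** For y <= n/2 the angle stays in [0, PI], where the cosine decreases. This carries the bound at y
    = 7/4 over to all larger y, so that only limits at fixed points are required. *)
Lemma chord_incr (n : nat) (x y : R) : (0 < n)%nat ->
  0 <= x -> x <= y -> y <= INR n / 2 -> chord n x <= chord n y.
Proof.
intros Hn Hx Hxy Hy; assert (HP := PI_RGT_0).
assert (HN : 0 < INR n) by (apply lt_0_INR; lia).
unfold chord; apply Rmult_le_compat_r; [left; apply Rinv_0_lt_compat; nra|].
apply Rmult_le_compat_l; [apply pow2_ge_0|].
assert (Hi := Rinv_0_lt_compat _ HN).
assert (Hb : forall t, 0 <= t <= INR n / 2 -> 0 <= 2 * PI * (t / INR n) <= PI).
{ intros t Ht; split.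
  - apply Rmult_le_pos; [lra | apply Rmult_le_pos; lra].
  - assert (t / INR n <= 1 / 2).
    { apply Rmult_le_reg_r with (INR n); auto; unfold Rdiv.
      rewrite Rmult_assoc, Rinv_l by lra; lra. }
    nra. }
apply Rplus_le_compat_l, Ropp_le_contravar, cos_decr_1; try apply Hb; try lra.
apply Rmult_le_compat_l; [lra|]; apply Rmult_le_compat_r; lra.
Qed.

(* [cos_sum f n y] is [- cos (2 PI y)] times a rational function of [X = chord n y] whose
   numerator tends to [(X - z1^2) (X - z2^2)]; written in powers of [X - 3], all the
   limit coefficients are positive. *)
Lemma cos_sum_sign (z1 z2 : R) : 1 / 2 < z1 -> z1 < 1 -> 1 < z2 -> z2 < 3 / 2 ->
  eventually (fun n : nat => forall y, 7 / 4 <= y <= INR n / 2 ->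
    cos_sum (phi_half z1 z2) n y * cos (2 * PI * y) <= 0).
Proof.
intros Hz1 Hz1' Hz2 Hz2'; assert (HP := PI_RGT_0).
assert (LQ1 := is_lim_seq_chord (1 / 4) ltac:(lra)).
assert (LQ2 := is_lim_seq_chord (3 / 4) ltac:(lra)).
assert (LQ3 := is_lim_seq_chord (5 / 4) ltac:(lra)).
assert (LX := is_lim_seq_chord (7 / 4) ltac:(lra)).
assert (LB : forall a q, 0 < q -> is_lim_seq (fun n => a * sine_ratio n q) a).
{ intros a q Hq.
  assert (H := is_lim_seq_scal_l _ a _ (is_lim_seq_sine_ratio q Hq)).
  simpl in H; rewrite Rmult_1_r in H; exact H. }
assert (LB1 := LB (amp1 z1 z2) (1 / 4) ltac:(lra)).
assert (LB2 := LB (amp2 z1 z2) (3 / 4) ltac:(lra)).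
assert (LB3 := LB (amp3 z1 z2) (5 / 4) ltac:(lra)).
(* The centre 3 is below 49/16, the limit of [chord n (7/4)], and above both the largest pole 25/16
   and z2^2 < 9/4. *)
assert (L3 := is_lim_seq_const 3).
assert (LC1 := is_lim_seq_minus' _ _ _ _ L3 LQ1).
assert (LC2 := is_lim_seq_minus' _ _ _ _ L3 LQ2).
assert (LC3 := is_lim_seq_minus' _ _ _ _ L3 LQ3).
assert (E2 := eventually_gt _ _ 0
  (is_lim_seq_plus' _ _ _ _ (is_lim_seq_plus' _ _ _ _ LB1 LB2) LB3)).
assert (E1 := eventually_gt _ _ 0
  (is_lim_seq_plus' _ _ _ _ (is_lim_seq_plus' _ _ _ _
    (is_lim_seq_mult' _ _ _ _ LB1 (is_lim_seq_plus' _ _ _ _ LC2 LC3))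
    (is_lim_seq_mult' _ _ _ _ LB2 (is_lim_seq_plus' _ _ _ _ LC1 LC3)))
    (is_lim_seq_mult' _ _ _ _ LB3 (is_lim_seq_plus' _ _ _ _ LC1 LC2)))).
assert (E0 := eventually_gt _ _ 0
  (is_lim_seq_plus' _ _ _ _ (is_lim_seq_plus' _ _ _ _
    (is_lim_seq_mult' _ _ _ _ LB1 (is_lim_seq_mult' _ _ _ _ LC2 LC3))
    (is_lim_seq_mult' _ _ _ _ LB2 (is_lim_seq_mult' _ _ _ _ LC1 LC3)))
    (is_lim_seq_mult' _ _ _ _ LB3 (is_lim_seq_mult' _ _ _ _ LC1 LC2)))).
(* The limit coefficients in powers of u = X - 3 are 1, then 6 - z1^2 - z2^2, then (3 - z1^2) (3 -
   z2^2). *)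
specialize (E2 ltac:(unfold amp1, amp2, amp3; lra)).
assert (0 < 9 / 4 - z2 ^ 2) by nra.
assert (0 < 1 - z1 ^ 2) by nra.
specialize (E1 ltac:(unfold amp1, amp2, amp3; field_simplify; nra)).
specialize (E0 ltac:(unfold amp1, amp2, amp3; field_simplify; nra)).
assert (EX := eventually_gt _ _ 3 LX ltac:(lra)).
assert (EC1 := eventually_gt _ _ 0 LC1 ltac:(lra)).
assert (EC2 := eventually_gt _ _ 0 LC2 ltac:(lra)).
assert (EC3 := eventually_gt _ _ 0 LC3 ltac:(lra)).
assert (EN : eventually (fun n => (0 < n)%nat)) by (exists 1%nat; intros; lia).
generalize (filter_and _ _ (filter_and _ _ (filter_and _ _ E0 E1) (filter_and _ _ E2 EX))
  (filter_and _ _ (filter_and _ _ EC1 EC2) (filter_and _ _ EC3 EN))).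
apply filter_imp; clear; intros n [[[E0 E1] [E2 EX]] [[EC1 EC2] [EC3 Hn]]] y [Hy Hyn].
assert (HP := PI_RGT_0).
assert (HX := chord_incr n (7 / 4) y Hn ltac:(lra) Hy Hyn).
assert (T1 := cos_sum_wave_chord (1 / 4) y n Hn ltac:(lra) cos_q1).
assert (T2 := cos_sum_wave_chord (3 / 4) y n Hn ltac:(lra) cos_q2).
assert (T3 := cos_sum_wave_chord (5 / 4) y n Hn ltac:(lra) cos_q3).
rewrite cos_sum_phi_half; unfold phi_comb.
set (t1 := cos_sum (wave (1 / 4)) n y) in *; set (t2 := cos_sum (wave (3 / 4)) n y) in *.
set (t3 := cos_sum (wave (5 / 4)) n y) in *; set (X := chord n y) in *.
set (c := cos (2 * PI * y)) in *.
set (Q1 := chord n (1 / 4)) in *; set (Q2 := chord n (3 / 4)) in *; set (Q3 := chord n (5 / 4)) in *.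
set (b1 := sine_ratio n (1 / 4)) in *; set (b2 := sine_ratio n (3 / 4)) in *; set (b3 := sine_ratio n (5 / 4)) in *.
set (a1 := amp1 z1 z2) in *; set (a2 := amp2 z1 z2) in *; set (a3 := amp3 z1 z2) in *.
(* All three differences are positive because X > 3 > Q_k, so the sign can be read off after
   multiplication by their product. *)
assert (P0 : 0 < (X - Q1) * (X - Q2) * (X - Q3))
  by (repeat apply Rmult_lt_0_compat; lra).
apply Rmult_le_reg_l with (1 := P0).
set (u := X - 3).
assert (Hu : 0 <= u) by (unfold u; lra).
set (d2 := a1 * b1 + a2 * b2 + a3 * b3) in *.
set (d1 := a1 * b1 * (3 - Q2 + (3 - Q3)) + a2 * b2 * (3 - Q1 + (3 - Q3)) +
  a3 * b3 * (3 - Q1 + (3 - Q2))) in *.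
set (d0 := a1 * b1 * ((3 - Q2) * (3 - Q3)) + a2 * b2 * ((3 - Q1) * (3 - Q3)) +
  a3 * b3 * ((3 - Q1) * (3 - Q2))) in *.
assert (EN : (X - Q1) * (X - Q2) * (X - Q3) *
  ((a1 * (4 * PI) * t1 + a2 * (4 / 3 * PI) * t2 + a3 * (4 / 5 * PI) * t3) * c) =
  - (c ^ 2 * (d2 * u ^ 2 + d1 * u + d0))).
{ transitivity (c * (
   a1 * (4 * PI) * (X - Q2) * (X - Q3) * ((X - Q1) * t1) +
   a2 * (4 / 3 * PI) * (X - Q1) * (X - Q3) * ((X - Q2) * t2) +
   a3 * (4 / 5 * PI) * (X - Q1) * (X - Q2) * ((X - Q3) * t3))); [ring|].
  rewrite T1, T2, T3; unfold d0, d1, d2, u; field; lra. }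
rewrite EN, Rmult_0_r.
assert (0 <= c ^ 2 * (d2 * u ^ 2 + d1 * u + d0)); [|lra].
apply Rmult_le_pos; [apply pow2_ge_0|].
assert (0 <= d2 * u ^ 2) by (apply Rmult_le_pos; [lra | apply pow2_ge_0]).
assert (0 <= d1 * u) by (apply Rmult_le_pos; lra).
lra.
Qed.

(** * Signs of the cosine and of the transform *)

Lemma cos_sign (m : nat) (y : R) :
  INR m / 2 - 1 / 4 < y < INR m / 2 + 1 / 4 -> 0 < (-1) ^ m * cos (2 * PI * y).
Proof.
assert (HP := PI_RGT_0).
revert y; induction m as [|m IH]; intros y Hy.
- simpl in *; rewrite Rmult_1_l; apply cos_gt_0; nra.
- rewrite S_INR in Hy; simpl pow.
  replace (2 * PI * y) with (2 * PI * (y - 1 / 2) + PI) by field.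
  rewrite neg_cos.
  assert (H := IH (y - 1 / 2) ltac:(lra)); lra.
Qed.

Lemma cos_sign_le (m : nat) (y : R) :
  INR m / 2 - 1 / 4 <= y <= INR m / 2 + 1 / 4 -> 0 <= (-1) ^ m * cos (2 * PI * y).
Proof.
assert (HP := PI_RGT_0).
revert y; induction m as [|m IH]; intros y Hy.
- simpl in *; rewrite Rmult_1_l; apply cos_ge_0; nra.
- rewrite S_INR in Hy; simpl pow.
  replace (2 * PI * y) with (2 * PI * (y - 1 / 2) + PI) by field.
  rewrite neg_cos.
  assert (H := IH (y - 1 / 2) ltac:(lra)); lra.
Qed.

Definition poles (y : R) : R := (1 / 16 - y ^ 2) * (9 / 16 - y ^ 2) * (25 / 16 - y ^ 2).

Lemma poles_factor (y : R) : poles y =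
  ((1 / 4 - y) * (3 / 4 - y) * (5 / 4 - y)) * ((1 / 4 + y) * (3 / 4 + y) * (5 / 4 + y)).
Proof. unfold poles; field. Qed.

(** Both factors are positive at 0 and change sign together at 1/4, 3/4 and 5/4; the next zero of
    the cosine is the endpoint 7/4. *)
Lemma poles_cos_ge0 (y : R) : 0 <= y <= 7 / 4 -> 0 <= poles y * cos (2 * PI * y).
Proof.
intros Hy; rewrite poles_factor, Rmult_assoc, (Rmult_comm (_ * _ * (5 / 4 + y))), <- Rmult_assoc.
assert (H0 := cos_sign_le 0 y); assert (H1 := cos_sign_le 1 y).
assert (H2 := cos_sign_le 2 y); assert (H3 := cos_sign_le 3 y); simpl in *.
apply Rmult_le_pos; [|repeat apply Rmult_le_pos; lra].
set (c := cos (2 * PI * y)) in *.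
destruct (Rle_lt_dec y (1 / 4)) as [L1|L1]; [|destruct (Rle_lt_dec y (3 / 4)) as [L2|L2];
  [|destruct (Rle_lt_dec y (5 / 4)) as [L3|L3]]].
- apply Rmult_le_pos; [repeat apply Rmult_le_pos; lra | lra].
- replace ((1 / 4 - y) * (3 / 4 - y) * (5 / 4 - y) * c) with
    ((y - 1 / 4) * (3 / 4 - y) * (5 / 4 - y) * (- c)) by ring.
  apply Rmult_le_pos; [repeat apply Rmult_le_pos; lra | lra].
- replace ((1 / 4 - y) * (3 / 4 - y) * (5 / 4 - y) * c) with
    ((y - 1 / 4) * (y - 3 / 4) * (5 / 4 - y) * c) by ring.
  apply Rmult_le_pos; [repeat apply Rmult_le_pos; lra | lra].
- replace ((1 / 4 - y) * (3 / 4 - y) * (5 / 4 - y) * c) with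
    ((y - 1 / 4) * (y - 3 / 4) * (y - 5 / 4) * (- c)) by ring.
  apply Rmult_le_pos; [repeat apply Rmult_le_pos; lra | lra].
Qed.

Lemma poles_eq_0 (y : R) : 0 <= y -> poles y = 0 -> y = 1 / 4 \/ y = 3 / 4 \/ y = 5 / 4.
Proof.
intros Hy H; rewrite poles_factor in H.
apply Rmult_integral in H; destruct H as [H|H].
- apply Rmult_integral in H; destruct H as [H|H]; [|lra].
  apply Rmult_integral in H; destruct H; lra.
- exfalso; revert H; apply Rgt_not_eq; repeat apply Rmult_lt_0_compat; lra.
Qed.

(** Away from the poles, [phi_hat_closed] and [poles_cos_ge0] leave only the sign of the numerator.
    At a pole the inequality follows by continuity from neighbouring points of [a, b]. *)
Lemma phi_hat_sign (z1 z2 s a b y : R) : 0 <= a -> a < b -> b <= 7 / 4 ->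
  (forall t, a <= t <= b -> 0 <= s * ((z1 ^ 2 - t ^ 2) * (z2 ^ 2 - t ^ 2))) ->
  a <= y <= b -> 0 <= s * phi_hat z1 z2 y.
Proof.
intros Ha Hab Hb Hs.
assert (Hne : forall t, a <= t <= b -> poles t <> 0 -> 0 <= s * phi_hat z1 z2 t).
{ intros t Ht Hp.
  assert (E := phi_hat_closed z1 z2 t); fold (poles t) in E.
  apply Rmult_le_reg_l with (poles t ^ 2).
  - assert (H := pow2_ge_0 (poles t)); assert (poles t ^ 2 <> 0) by (apply pow_nonzero; auto); lra.
  - replace (poles t ^ 2 * (s * phi_hat z1 z2 t)) with
      (s * poles t * (poles t * phi_hat z1 z2 t)) by ring.
    rewrite E, Rmult_0_r.
    replace (s * poles t * ((z1 ^ 2 - t ^ 2) * (z2 ^ 2 - t ^ 2) * cos (2 * PI * t))) with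
      (s * ((z1 ^ 2 - t ^ 2) * (z2 ^ 2 - t ^ 2)) * (poles t * cos (2 * PI * t))) by ring.
    apply Rmult_le_pos; [apply Hs; auto | apply poles_cos_ge0; lra]. }
intros Hy; destruct (Req_dec (poles y) 0) as [H0|H0]; [|auto].
destruct (Rle_lt_dec 0 (s * phi_hat z1 z2 y)) as [L|L]; [exact L|exfalso].
assert (Hc : continuous (fun t => s * phi_hat z1 z2 t) y)
  by (apply (continuous_scal_r (K := R_AbsRing) (V := R_NormedModule)), continuous_phi_hat).
destruct (Hc (fun t => t < 0) (open_lt 0 _ L)) as [d Hd].
assert (Hd0 := cond_pos d).
(* The three bounds keep the shifted point in the ball of continuity, in [a, b] when moving towards
   the farther end, and off the other poles, which are at distance at least 1/2. *)
set (e := Rmin (d / 2) (Rmin ((b - a) / 2) (1 / 4))).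
assert (He : 0 < e) by (repeat apply Rmin_pos; lra).
assert (He1 : e <= d / 2) by apply Rmin_l.
assert (He2 : e <= (b - a) / 2) by (apply Rle_trans with (1 := Rmin_r _ _), Rmin_l).
assert (He3 : e <= 1 / 4) by (apply Rle_trans with (1 := Rmin_r _ _), Rmin_r).
assert (Hp := poles_eq_0 y ltac:(lra) H0).
assert (Hball : forall t, Rabs (t - y) < d -> s * phi_hat z1 z2 t < 0) by (intros t; apply Hd).
destruct (Rle_lt_dec y ((a + b) / 2)) as [Hl|Hl].
- assert (s * phi_hat z1 z2 (y + e) < 0).
  { apply Hball; replace (y + e - y) with e by ring; rewrite Rabs_right; lra. }
  assert (0 <= s * phi_hat z1 z2 (y + e)); [|lra].
  apply Hne; [lra|]; intros Hp'; apply poles_eq_0 in Hp'; lra.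
- assert (s * phi_hat z1 z2 (y - e) < 0).
  { apply Hball; replace (y - e - y) with (- e) by ring.
    rewrite Rabs_Ropp, Rabs_right; lra. }
  assert (0 <= s * phi_hat z1 z2 (y - e)); [|lra].
  apply Hne; [lra|]; intros Hp'; apply poles_eq_0 in Hp'; lra.
Qed.

(** * The two norms *)

Lemma continuous_abs (f : R -> R) (x : R) :
  continuous f x -> continuous (fun t => Rabs (f t)) x.
Proof. intros H; apply (continuous_comp f Rabs); [exact H | apply continuous_Rabs]. Qed.

Lemma RInt_abs_sign (f : R -> R) (s a b : R) : a <= b -> Rabs s = 1 ->
  (forall x, continuous f x) -> (forall x, a < x < b -> 0 <= s * f x) ->
  RInt (fun x => Rabs (f x)) a b = s * RInt f a b.
Proof.
intros Hab Hs Hc H.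
rewrite <- (RInt_scal (V := R_CompleteNormedModule)) by apply ex_RInt_of_continuous, Hc.
apply RInt_ext; intros x; rewrite Rmin_left, Rmax_right by lra; intros Hx.
change (Rabs (f x) = s * f x).
rewrite <- (Rabs_right (s * f x)) by (apply Rle_ge, H, Hx).
rewrite Rabs_mult, Hs; ring.
Qed.

(** The sign pattern is that of (z1^2 - y^2) (z2^2 - y^2), namely +, -, + on [0, z1], [z1, z2] and
    [z2, 7/4]. *)
Lemma RInt_abs_phi_hat (z1 z2 : R) : 1 / 2 < z1 -> z1 < 1 -> 1 < z2 -> z2 < 3 / 2 ->
  RInt (fun y => Rabs (phi_hat z1 z2 y)) 0 (7 / 4) =
  RInt (phi_hat z1 z2) 0 (7 / 4) - 2 * RInt (phi_hat z1 z2) z1 z2.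
Proof.
intros Hz1 Hz1' Hz2 Hz2'.
assert (Hc := continuous_phi_hat z1 z2).
assert (Ha := fun y => continuous_abs _ y (Hc y)).
rewrite (RInt_split _ 0 z1 (7 / 4)), (RInt_split _ z1 z2 (7 / 4)) by exact Ha.
rewrite (RInt_split (phi_hat z1 z2) 0 z1 (7 / 4)), (RInt_split _ z1 z2 (7 / 4)) by exact Hc.
assert (Hp : forall u v, u <= v -> 0 <= u -> 0 <= v ^ 2 - u ^ 2).
{ intros u v H1 H2; nra. }
rewrite (RInt_abs_sign _ 1 0 z1), (RInt_abs_sign _ (-1) z1 z2),
  (RInt_abs_sign _ 1 z2 (7 / 4)); try exact Hc; try lra;
  try (apply Rabs_R1 || (rewrite Rabs_left; lra)).
- intros x Hx; apply phi_hat_sign with z2 (7 / 4); try lra.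
  intros t Ht; rewrite Rmult_1_l.
  assert (H1 := Hp z1 t ltac:(lra) ltac:(lra)); assert (H2 := Hp z2 t ltac:(lra) ltac:(lra)).
  nra.
- intros x Hx; apply phi_hat_sign with z1 z2; try lra.
  intros t Ht.
  assert (H1 := Hp z1 t ltac:(lra) ltac:(lra)); assert (H2 := Hp t z2 ltac:(lra) ltac:(lra)).
  nra.
- intros x Hx; apply phi_hat_sign with 0 z1; try lra.
  intros t Ht; rewrite Rmult_1_l.
  assert (H1 := Hp t z1 ltac:(lra) ltac:(lra)); assert (H2 := Hp t z2 ltac:(lra) ltac:(lra)).
  apply Rmult_le_pos; auto.
Qed.

Lemma phi_hat_pos (z1 z2 y : R) : 1 / 2 < z1 -> z1 < 1 -> 1 < z2 -> z2 < 3 / 2 ->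
  0 < y < 1 / 4 -> 0 < phi_hat z1 z2 y.
Proof.
intros Hz1 Hz1' Hz2 Hz2' Hy; assert (HP := PI_RGT_0).
assert (E := phi_hat_closed z1 z2 y).
assert (Hcos : 0 < cos (2 * PI * y)) by (apply cos_gt_0; nra).
assert (0 < (z1 ^ 2 - y ^ 2) * (z2 ^ 2 - y ^ 2) * cos (2 * PI * y)).
{ apply Rmult_lt_0_compat; auto; apply Rmult_lt_0_compat; nra. }
assert (0 < (1 / 16 - y ^ 2) * (9 / 16 - y ^ 2) * (25 / 16 - y ^ 2)).
{ apply Rmult_lt_0_compat; [apply Rmult_lt_0_compat|]; nra. }
rewrite <- E in H.
apply Rmult_lt_reg_l with (1 := H0); rewrite Rmult_0_r; exact H.
Qed.

(** On the far range |h| = - sgn (cos (2 PI y)) h for h = [cos_sum f n], and by [alt_sum_prim] sgn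
    (cos (2 PI y)) h has integral 0 over [0, n/2]. So the left side is its integral over [0, 7/4],
    whose pieces between the zeros of the cosine give the right side. *)
Lemma RInt_abs_cos_sum_far (f : R -> R) (n : nat) : (4 <= n)%nat ->
  (forall y, 7 / 4 <= y <= INR n / 2 -> cos_sum f n y * cos (2 * PI * y) <= 0) ->
  RInt (fun y => Rabs (cos_sum f n y)) (7 / 4) (INR n / 2) =
  2 * RInt (cos_sum f n) 0 (1 / 4) - 2 * RInt (cos_sum f n) 0 (3 / 4) +
  2 * RInt (cos_sum f n) 0 (5 / 4) - RInt (cos_sum f n) 0 (7 / 4).
Proof.
intros Hn4 Hs; assert (Hn : (0 < n)%nat) by lia.
assert (Hc := fun y => continuous_cos_sum f n y Hn).
assert (Ha := fun y => continuous_abs _ y (Hc y)).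
set (G := cos_sum_prim f n).
assert (Hpiece : forall m a b, INR m / 2 - 1 / 4 <= a -> a <= b -> b <= INR m / 2 + 1 / 4 ->
  7 / 4 <= a -> b <= INR n / 2 ->
  RInt (fun y => Rabs (cos_sum f n y)) a b = - (-1) ^ m * (G b - G a)).
{ intros m a b H1 H2 H3 H4 H5; unfold G; rewrite <- RInt_cos_sum by exact Hn.
  apply RInt_abs_sign; auto.
  - rewrite Rabs_Ropp; apply pow_1_abs.
  - intros x Hx.
    assert (Hcs := cos_sign m x ltac:(lra)); assert (Hx' := Hs x ltac:(lra)).
    assert (E : (-1) ^ m * (-1) ^ m = 1) by (rewrite <- Rpow_mult_distr; replace (-1 * -1) with 1 by ring; apply pow1).
    apply Rmult_le_reg_r with (1 := Hcs); rewrite Rmult_0_l.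
    replace (- (-1) ^ m * cos_sum f n x * ((-1) ^ m * cos (2 * PI * x))) with
      (- ((-1) ^ m * (-1) ^ m) * (cos_sum f n x * cos (2 * PI * x))) by ring.
    rewrite E; lra. }
(* Adds up the pieces between consecutive zeros of the cosine, starting from 7/4 = 4/2 - 1/4. The
   remaining piece from n/2 - 1/4 to n/2 is only half as long and is added separately below. *)
assert (Hm : forall m, (4 <= m)%nat -> (m <= n)%nat ->
  RInt (fun y => Rabs (cos_sum f n y)) (7 / 4) (INR m / 2 - 1 / 4) =
  alt_sum G 4 + G (7 / 4) - alt_sum G m - (-1) ^ m * G (INR m / 2 - 1 / 4)).
{ intros m H4; induction H4 as [|m H4 IH]; intros Hmn.
  - replace (INR 4 / 2 - 1 / 4) with (7 / 4) by (simpl; field).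
    rewrite (RInt_point (V := R_CompleteNormedModule)); unfold zero; simpl; ring.
  - rewrite (RInt_split _ _ (INR m / 2 - 1 / 4)) by exact Ha.
    assert (Hmn' := le_INR _ _ Hmn); assert (H4' := le_INR _ _ H4).
    rewrite (S_INR m) in *; simpl (INR 4) in H4'.
    rewrite IH by lia.
    rewrite (Hpiece m) by lra.
    rewrite alt_sum_S; simpl ((-1) ^ S m).
    replace ((INR m + 1) / 2 - 1 / 4) with (INR m / 2 + 1 / 4) by field.
    change (@eq R (alt_sum G 4 + G (7 / 4) - alt_sum G m - (-1) ^ m * G (INR m / 2 - 1 / 4) +
      - (-1) ^ m * (G (INR m / 2 + 1 / 4) - G (INR m / 2 - 1 / 4)))
      (alt_sum G 4 + G (7 / 4) - (alt_sum G m + 2 * ((-1) ^ m * G (INR m / 2 + 1 / 4))) -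
       -1 * (-1) ^ m * G (INR m / 2 + 1 / 4))); ring. }
assert (H4' := le_INR _ _ Hn4); simpl (INR 4) in H4'.
rewrite (RInt_split _ _ (INR n / 2 - 1 / 4)), (Hm n), (Hpiece n) by (try exact Ha; lia || lra).
assert (E := alt_sum_prim f n Hn); fold G in E.
rewrite !RInt_cos_sum by exact Hn; fold G.
assert (E0 : G 0 = 0) by apply cos_sum_prim_0.
rewrite E0.
replace (alt_sum G n) with (- ((-1) ^ n * G (INR n / 2))) by lra.
unfold alt_sum.
replace (INR 0 / 2 + 1 / 4) with (1 / 4) by (simpl; field).
replace (INR 1 / 2 + 1 / 4) with (3 / 4) by (simpl; field).
replace (INR 2 / 2 + 1 / 4) with (5 / 4) by (simpl; field).
replace (INR 3 / 2 + 1 / 4) with (7 / 4) by (simpl; field).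
simpl; ring.
Qed.

Lemma normL_F (z1 z2 : R) (n : nat) : (0 < n)%nat ->
  normL (F z1 z2 n) =
  2 * RInt (fun y => Rabs (cos_sum (phi_half z1 z2) n y)) 0 (INR n / 2).
Proof.
intros Hn; assert (HN : 0 < INR n) by (apply lt_0_INR; lia).
set (g := fun y => Rabs (cos_sum (phi_half z1 z2) n y)).
assert (Hg : forall y, continuous g y)
  by (intros y; apply continuous_abs, continuous_cos_sum, Hn).
(* The summand 0 matches the affine substitution in [RInt_comp_lin]. *)
set (k := fun x => INR n * g (INR n * x + 0)).
assert (Hk : forall x, continuous k x).
{ intros x; apply (continuous_scal_r (K := R_AbsRing) (V := R_NormedModule)).
  apply (continuous_comp (fun x => INR n * x + 0) g); [|apply Hg].
  apply (ex_derive_continuous (K := R_AbsRing) (V := R_NormedModule)); auto_derive; auto. }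
unfold normL; rewrite (RInt_ext _ k).
2: { intros x _; rewrite F_cos_sum, Cmod_R, Rabs_mult, (Rabs_right (INR n)) by (auto; lra).
  unfold k, g; rewrite Rplus_0_r; reflexivity. }
rewrite RInt_even; auto.
- f_equal.
  assert (H := RInt_comp_lin (V := R_CompleteNormedModule) g (INR n) 0 0 (1 / 2)).
  change (RInt k 0 (1 / 2) = RInt g 0 (INR n / 2)).
  replace (INR n / 2) with (INR n * (1 / 2) + 0) by field.
  rewrite Rmult_0_r, Rplus_0_l in H.
  apply H, ex_RInt_of_continuous, Hg.
- intros x; unfold k, g; f_equal; f_equal.
  unfold cos_sum; f_equal; f_equal; f_equal; apply sum1_ext; intros i _.
  f_equal; rewrite <- cos_neg; f_equal; ring.
Qed.

(** The left side is |F| at x = 0. The upper bound [B] is required as well, because [real] would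
    send an infinite supremum to 0. *)
Lemma normC_F_ge (z1 z2 : R) (n : nat) : (0 < n)%nat ->
  Rabs (INR n * cos_sum (phi_half z1 z2) n 0) <= normC (F z1 z2 n).
Proof.
intros Hn; assert (HN : 0 < INR n) by (apply lt_0_INR; lia).
set (E := fun y => exists x, Rabs x <= 1 / 2 /\ y = Cmod (F z1 z2 n x)).
set (f := phi_half z1 z2).
set (B := INR n * (/ INR n * (Rabs (f 0) +
  2 * sum1 (fun i => Rabs (f (INR i / INR n))) (pred n)))).
assert (Hub : is_ub_Rbar E B).
{ intros y [x [_ ->]]; simpl.
  rewrite F_cos_sum, Cmod_R, Rabs_mult, (Rabs_right (INR n)) by (auto; lra).
  apply Rmult_le_compat_l; [lra|]; unfold cos_sum; fold f.
  rewrite Rabs_mult, Rabs_right by (apply Rle_ge; left; apply Rinv_0_lt_compat, HN).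
  apply Rmult_le_compat_l; [left; apply Rinv_0_lt_compat, HN|].
  apply Rle_trans with (1 := Rabs_triang _ _), Rplus_le_compat_l.
  rewrite Rabs_mult, (Rabs_right 2) by lra.
  apply Rmult_le_compat_l; [lra|]; apply Rabs_sum1_le; intros i _.
  rewrite Rabs_mult, <- Rmult_1_r.
  apply Rmult_le_compat_l; [apply Rabs_pos | apply Rabs_cos_le]. }
destruct (Lub_Rbar_correct E) as [H1 H2].
assert (H0 : Rbar_le (Cmod (F z1 z2 n 0)) (Lub_Rbar E)).
{ apply H1; exists 0; rewrite Rabs_R0; split; [lra | reflexivity]. }
assert (H3 := H2 _ Hub).
unfold normC; fold E.
destruct (Lub_Rbar E) as [l| |]; simpl in H0, H3; try contradiction.
apply Rle_trans with (2 := H0).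
rewrite F_cos_sum, Cmod_R, Rmult_0_r by exact Hn; apply Rle_refl.
Qed.

Definition L1norm (z1 z2 : R) : R :=
  4 * (RInt (phi_hat z1 z2) 0 (1 / 4) + RInt (phi_hat z1 z2) (3 / 4) (5 / 4) -
       RInt (phi_hat z1 z2) z1 z2).

Lemma RInt_cos_sum_error (z1 z2 y : R) (n : nat) : (0 < n)%nat -> 0 <= y <= 7 / 4 ->
  Rabs (RInt (cos_sum (phi_half z1 z2) n) 0 y - RInt (phi_hat z1 z2) 0 y) <=
  7 / 4 * (error_const z1 z2 / INR n ^ 2).
Proof.
intros Hn Hy.
assert (He : 0 <= error_const z1 z2 / INR n ^ 2).
{ apply Rmult_le_pos; [apply error_const_pos | left].
  apply Rinv_0_lt_compat, pow_lt, lt_0_INR; lia. }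
apply Rle_trans with ((y - 0) * (error_const z1 z2 / INR n ^ 2)).
- apply RInt_approx; [lra | intros x; apply continuous_cos_sum, Hn | apply continuous_phi_hat |].
  intros x Hx; apply cos_sum_error; [exact Hn | lra].
- apply Rmult_le_compat_r; lra.
Qed.

(** The upper bound yields the denominator of [rho]: the integrals of [phi_hat] up to 7/4 from the
    near and far ranges cancel. The cruder lower bound keeps only [0, 1/4] and serves for
    positivity. *)
Lemma normL_F_bounds (z1 z2 : R) : 1 / 2 < z1 -> z1 < 1 -> 1 < z2 -> z2 < 3 / 2 ->
  eventually (fun n : nat =>
    2 * RInt (phi_hat z1 z2) 0 (1 / 4) - 4 * (error_const z1 z2 / INR n ^ 2)
      <= normL (F z1 z2 n)
      <= L1norm z1 z2 + 28 * (error_const z1 z2 / INR n ^ 2)).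
Proof.
intros Hz1 Hz1' Hz2 Hz2'.
assert (E4 : eventually (fun n => (4 <= n)%nat)) by (exists 4%nat; auto).
generalize (filter_and _ _ E4 (cos_sum_sign z1 z2 Hz1 Hz1' Hz2 Hz2')).
apply filter_imp; intros n [Hn4 Hs]; assert (Hn : (0 < n)%nat) by lia.
assert (HN := le_INR _ _ Hn4); simpl (INR 4) in HN.
set (h := cos_sum (phi_half z1 z2) n) in *; set (H := phi_hat z1 z2).
set (e := error_const z1 z2 / INR n ^ 2).
assert (Hch : forall y, continuous h y) by (intros y; apply continuous_cos_sum, Hn).
assert (HcH : forall y, continuous H y) by apply continuous_phi_hat.
assert (Hah := fun y => continuous_abs _ y (Hch y)).
assert (HaH := fun y => continuous_abs _ y (HcH y)).
assert (Hfar := RInt_abs_cos_sum_far (phi_half z1 z2) n Hn4 Hs); fold h in Hfar.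
assert (Hge : forall a b, a <= b -> 0 <= RInt (fun y => Rabs (h y)) a b).
{ intros a b Hab; apply RInt_ge_0; [exact Hab | apply ex_RInt_of_continuous, Hah |].
  intros x _; apply Rabs_pos. }
assert (I1 := RInt_cos_sum_error z1 z2 (1 / 4) n Hn ltac:(lra)).
assert (I3 := RInt_cos_sum_error z1 z2 (3 / 4) n Hn ltac:(lra)).
assert (I5 := RInt_cos_sum_error z1 z2 (5 / 4) n Hn ltac:(lra)).
assert (I7 := RInt_cos_sum_error z1 z2 (7 / 4) n Hn ltac:(lra)).
fold h H e in I1, I3, I5, I7.
apply Rabs_le_between in I1; apply Rabs_le_between in I3.
apply Rabs_le_between in I5; apply Rabs_le_between in I7.
assert (IA : Rabs (RInt (fun y => Rabs (h y)) 0 (7 / 4) -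
  RInt (fun y => Rabs (H y)) 0 (7 / 4)) <= (7 / 4 - 0) * e).
{ apply RInt_approx; [lra | exact Hah | exact HaH |].
  intros x Hx; apply Rle_trans with (1 := Rabs_triang_inv2 _ _).
  apply cos_sum_error; [exact Hn | lra]. }
apply Rabs_le_between in IA.
assert (IH := RInt_abs_phi_hat z1 z2 Hz1 Hz1' Hz2 Hz2'); fold H in IH.
rewrite IH in IA.
assert (ES := RInt_split H 0 (3 / 4) (5 / 4) HcH).
rewrite normL_F by exact Hn; fold h.
unfold L1norm; fold H.
assert (E1 := RInt_split (fun y : R => Rabs (h y)) 0 (7 / 4) (INR n / 2) Hah).
assert (E2 := RInt_split (fun y : R => Rabs (h y)) 0 (1 / 4) (INR n / 2) Hah).
assert (G1 := Hge (1 / 4) (INR n / 2) ltac:(lra)).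
assert (G2 : RInt h 0 (1 / 4) <= RInt (fun y => Rabs (h y)) 0 (1 / 4)).
{ apply RInt_le; [lra | apply ex_RInt_of_continuous, Hch | apply ex_RInt_of_continuous, Hah |].
  intros x _; apply Rle_abs. }
assert (He : 0 <= e).
{ apply Rmult_le_pos; [apply error_const_pos | left].
  apply Rinv_0_lt_compat, pow_lt; lra. }
(* The near range costs 7/4 e and the far range (2 + 2 + 2 + 1) 7/4 e; doubled, this is 28 e. In the
   lower bound 2 (7/4) e <= 4 e. *)
split; lra.
Qed.

Lemma is_lim_seq_div_sqr (K : R) : is_lim_seq (fun n => K / INR n ^ 2) 0.
Proof.
assert (Hi : is_lim_seq (fun n => / INR n) 0)
  by (apply (is_lim_seq_inv _ _ is_lim_seq_INR); discriminate).
assert (H := is_lim_seq_scal_l _ K _ (is_lim_seq_mult' _ _ _ _ Hi Hi)).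
simpl in H; rewrite Rmult_0_r, Rmult_0_r in H.
apply is_lim_seq_ext with (2 := H); intros n.
unfold Rdiv; simpl; rewrite Rmult_1_r, Rinv_mult; reflexivity.
Qed.

(** Positivity of [L1norm] comes from comparing the two bounds of [normL_F_bounds] at a single large
    n: it exceeds 2 I - 32 e, hence the threshold I/32 for e. *)
Lemma normL_F_pos (z1 z2 : R) : 1 / 2 < z1 -> z1 < 1 -> 1 < z2 -> z2 < 3 / 2 ->
  0 < L1norm z1 z2 /\ eventually (fun n : nat => 0 < normL (F z1 z2 n)).
Proof.
intros Hz1 Hz1' Hz2 Hz2'.
assert (Hpos : 0 < RInt (phi_hat z1 z2) 0 (1 / 4)).
{ apply RInt_gt_0; [lra | | intros; apply continuous_phi_hat].
  intros x Hx; apply phi_hat_pos; auto. }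
set (I := RInt (phi_hat z1 z2) 0 (1 / 4)) in *.
assert (Hs := eventually_gt _ _ (- I / 32)
  (is_lim_seq_div_sqr (- error_const z1 z2)) ltac:(lra)).
assert (Hb := filter_and _ _ Hs (normL_F_bounds z1 z2 Hz1 Hz1' Hz2 Hz2')).
fold I in Hb.
assert (E : forall n, - error_const z1 z2 / INR n ^ 2 = - (error_const z1 z2 / INR n ^ 2))
  by (intros n; unfold Rdiv; ring).
split.
- destruct Hb as [N HN]; destruct (HN N (le_n N)) as [H1 H2]; rewrite E in H1; lra.
- revert Hb; apply filter_imp; intros n [H1 H2]; rewrite E in H1; lra.
Qed.

Theorem mainTheorem1 :
  forall z1 z2 : R,
    1 / 2 < z1 -> z1 < 1 -> 1 < z2 -> z2 < 3 / 2 ->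
    exists K : R,
      eventually (fun n : nat =>
        normC (F z1 z2 n) / normL (F z1 z2 n) >= rho z1 z2 * INR n - K / INR n).
Proof.
intros z1 z2 Hz1 Hz1' Hz2 Hz2'.
destruct (normL_F_pos z1 z2 Hz1 Hz1' Hz2 Hz2') as [HD Hpos].
set (D := L1norm z1 z2) in *; set (H0 := phi_hat z1 z2 0); set (K := error_const z1 z2).
assert (Erho : rho z1 z2 = H0 / D).
{ unfold rho, H0, D, L1norm.
  rewrite !(RInt_ext (fun z => Re (phihat z1 z2 z)) (phi_hat z1 z2))
    by (intros; apply Re_phihat).
  rewrite Re_phihat; reflexivity. }
rewrite Erho.
assert (HK : 0 <= K) by apply error_const_pos.
(* The numerator is at least N H0 - K/N and the denominator at most D + 28 K/N^2. To first order
   these corrections cost K/(D N) and 28 K H0/(D^2 N); the absolute value keeps the constant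
   nonnegative. *)
exists ((K + 28 * K * (Rabs H0 / D)) / D).
assert (EN : eventually (fun n => (0 < n)%nat)) by (exists 1%nat; intros; lia).
generalize (filter_and _ _ (filter_and _ _ EN Hpos)
  (normL_F_bounds z1 z2 Hz1 Hz1' Hz2 Hz2')).
apply filter_imp; intros n [[Hn Hp] [_ Hle]]; apply Rle_ge.
assert (HN : 0 < INR n) by (apply lt_0_INR; lia).
fold D K in Hle.
assert (HC := normC_F_ge z1 z2 n Hn).
assert (Herr := cos_sum_error z1 z2 0 n Hn ltac:(lra)).
apply Rabs_le_between in Herr; fold H0 K in Herr.
set (N := INR n) in *; set (L := normL (F z1 z2 n)) in *; set (M := normC (F z1 z2 n)) in *.
set (K2 := (K + 28 * K * (Rabs H0 / D)) / D).
set (t := cos_sum (phi_half z1 z2) n 0) in *.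
assert (HaD : 0 <= Rabs H0 / D).
{ apply Rmult_le_pos; [apply Rabs_pos | left; apply Rinv_0_lt_compat, HD]. }
assert (HK2 : 0 <= K2).
{ apply Rmult_le_pos; [|left; apply Rinv_0_lt_compat, HD].
  assert (0 <= K * (Rabs H0 / D)) by (apply Rmult_le_pos; auto); lra. }
assert (HM0 : 0 <= M) by (apply Rle_trans with (2 := HC), Rabs_pos).
assert (HM : N * (H0 - K / N ^ 2) <= M).
{ apply Rle_trans with (2 := HC), Rle_trans with (2 := Rle_abs _).
  apply Rmult_le_compat_l; lra. }
apply Rmult_le_reg_r with (1 := Hp).
replace (M / L * L) with M by (field; lra).
set (v := H0 / D * N - K2 / N).
(* The upper bound for [L] may be multiplied by [v] only when [v] is nonnegative; otherwise the
   claim follows from M >= 0. *)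
destruct (Rle_lt_dec v 0) as [Hv|Hv].
{ apply Rle_trans with (2 := HM0).
  replace (v * L) with (- ((- v) * L)) by ring.
  assert (0 <= - v * L) by (apply Rmult_le_pos; lra); lra. }
apply Rle_trans with (v * (D + 28 * (K / N ^ 2))); [apply Rmult_le_compat_l; lra|].
apply Rle_trans with (2 := HM).
(* With this [K2] the terms of order N cancel, and those of order 1/N and 1/N^3 are nonnegative. *)
assert (Hd : N * (H0 - K / N ^ 2) - v * (D + 28 * (K / N ^ 2)) =
  28 * K / N * (Rabs H0 / D - H0 / D) + 28 * K * K2 / N ^ 3).
{ unfold v, K2; field; lra. }
assert (0 <= 28 * K / N * (Rabs H0 / D - H0 / D)).
{ apply Rmult_le_pos.
  - apply Rmult_le_pos; [lra | left; apply Rinv_0_lt_compat, HN].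
  - unfold Rdiv; rewrite <- Rmult_minus_distr_r.
    apply Rmult_le_pos; [assert (H := Rle_abs H0); lra | left; apply Rinv_0_lt_compat, HD]. }
assert (0 <= 28 * K * K2 / N ^ 3).
{ apply Rmult_le_pos; [apply Rmult_le_pos; lra|].
  left; apply Rinv_0_lt_compat, pow_lt, HN. }
lra.
Qed.
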